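(* Let $d\ge1$, let $\phi\in\mathbb{R}^{d+1}\setminus S^d$, and let $A\subset S^d$ be a Borel set. Then $$\int_A f(y;\phi)\,dy=\frac{\mathrm{Area}\{\mathcal{M}_{I,-\phi}(A)\}}{\mathrm{Area}(S^d)},$$ where $dy$ and $\mathrm{Area}(\cdot)$ refer to the surface measure on $S^d$.
   Context: $S^d=\{x\in\mathbb{R}^{d+1}:\|x\|=1\}$; $I$ is the $(d+1)\times(d+1)$ identity matrix. $f(y;\phi)$ is the spherical Cauchy density $$f(y;\phi)=\frac{\Gamma\{(d+1)/2\}}{2\pi^{(d+1)/2}}\left(\frac{|1-\|\phi\|^2|}{\|y-\phi\|^2}\right)^d,\quad y\in S^d.$$ For $\psi\in\mathbb{R}^{d+1}\setminus S^d$ the Möbius transformation $\mathcal{M}_{I,\psi}$ acts on $S^d$ by $$\mathcal{M}_{I,\psi}(y)=\frac{1-\|\psi\|^2}{\|y+\psi\|^2}(y+\psi)+\psi,\quad y\in S^d,$$ and maps $S^d$ onto itself. *)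

(* Defs.v *)
(* Library: MathComp-Analysis. *)
From HB Require Import structures.
From mathcomp Require Import all_boot all_order all_algebra.
From mathcomp Require Import all_classical all_reals all_analysis.

Set Implicit Arguments.
Unset Strict Implicit.
Unset Printing Implicit Defensive.

Import Order.TTheory GRing.Theory Num.Theory.
Import numFieldNormedType.Exports.

Local Open Scope classical_set_scope.
Local Open Scope ring_scope.

(* R^n (row vectors) with its Borel sigma-algebra, the one generated by the
   open sets. *)
Definition borelRn (R : realType) (n : nat) :=
  g_sigma_algebraType (@open 'rV[R]_n).

Definition cons_row (R : realType) (n : nat) (p : R * borelRn R n) :
    borelRn R n.+1 :=
  row_mx (const_mx p.1 : 'rV_1) (p.2 : 'rV[R]_n).

Section borel_rows.
Context (R : realType).

Lemma cons_row0 n (p : R * borelRn R n) :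
  (cons_row p : 'rV[R]_(1 + n)) ord0 (lshift n ord0) = p.1.
Proof. by rewrite /cons_row (row_mxEl (const_mx p.1 : 'rV_1)) mxE. Qed.

Lemma cons_rowS n (p : R * borelRn R n) (j : 'I_n) :
  (cons_row p : 'rV[R]_(1 + n)) ord0 (rshift 1 j) = (p.2 : 'rV[R]_n) ord0 j.
Proof. by rewrite /cons_row (row_mxEr (const_mx p.1 : 'rV_1)). Qed.

Lemma open_measurableRn n (U : set 'rV[R]_n) :
  open U -> measurable (U : set (borelRn R n)).
Proof. by move=> oU; exact: sub_sigma_algebra. Qed.

Let ratr_row n (q : 'rV[rat]_n) : 'rV[R]_n := map_mx ratr q.

Lemma open_bigcup_balls n (U : set 'rV[R]_n) : open U ->
  U = \bigcup_(i : 'rV[rat]_n * nat)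
    (if `[< ball (ratr_row i.1) (i.2.+1%:R^-1 : R) `<=` U >]
     then ball (ratr_row i.1) (i.2.+1%:R^-1 : R) else set0).
Proof.
move=> oU; apply/seteqP; split => [x Ux|x [[q k] _] /=]; last first.
  by case: ifPn => // /asboolP; exact.
have /nbhs_ballP[e /= e0 xeU] : nbhs x U by exact: open_nbhs_nbhs.
have [k hk] : exists k : nat, (k.+1%:R^-1 : R) < e / 2.
  exists (Num.truncn (2 / e)).
  rewrite -(invrK (e / 2)) ltf_pV2 ?posrE// ?invr_gt0 ?divr_gt0//.
  by rewrite invf_div truncnS_gt.
have k0 : 0 < (k.+1%:R^-1 : R) by rewrite invr_gt0.
have qP (j : 'I_n) : exists q : rat,
    `|ratr q - x ord0 j| < k.+1%:R^-1 :> R.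
  have [|q] := @rat_in_itvoo _ (x ord0 j - k.+1%:R^-1) (x ord0 j + k.+1%:R^-1).
    by rewrite ltrD2l gtrN.
  rewrite in_itv/= => qx; exists q.
  by rewrite ltr_distl.
have [q qE] := choice qP.
pose Q : 'rV[rat]_n := \row_j q j.
exists (Q, k) => //=; rewrite ifT; last first.
  apply/asboolP => y [_ Qy]; apply: xeU; split=> // i j.
  move: (Qy i j); rewrite /ball/= !mxE !ord1 => h.
  rewrite (_ : _ - _ = - (ratr (q j) - x ord0 j) + (ratr (q j) - y ord0 j)).
    rewrite (le_lt_trans (ler_normD _ _))// normrN [ltRHS]splitr ltrD//.
      exact: (lt_trans (qE j)).
    exact: lt_trans h _.
  by rewrite opprB addrA subrK.
split => // i j; rewrite /ball/= !mxE !ord1; exact: qE.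
Qed.

Lemma measurable_cons_row n : measurable_fun setT (@cons_row R n).
Proof.
refine (@measurability _ _ _ (borelRn R n.+1) setT (@cons_row R n) (@open 'rV[R]_n.+1) erefl _).
move=> _ [U oU <-]; rewrite setTI (open_bigcup_balls oU) preimage_bigcup.
apply: countable_bigcupT_measurable => // -[q k] /=.
case: ifPn => _; last by rewrite preimage_set0.
set z : 'rV[R]_(1 + n) := ratr_row q; set r := _^-1.
rewrite (_ : _ @^-1` _ =
    ball (z ord0 (lshift n (ord0 : 'I_1))) r `*`
    (ball (rsubmx z) r : set 'rV[R]_n)).
  apply: measurableX; first exact: measurable_realfun.measurable_ball.
  apply: open_measurableRn; exact: ball_open.
apply/seteqP; split => [[a v] [r0 h]|[a v] /= [ha [r0 hv]]].
  split => /=.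
    by have := h ord0 (lshift n (ord0 : 'I_1)); rewrite (cons_row0 (a, v)).
  split=> // i j; have := h ord0 (rshift 1 j).
  rewrite (cons_rowS (a, v)) (ord1 i) [rsubmx z _ _]mxE; exact.
split => // i j; rewrite (ord1 i).
rewrite -(@splitK 1 n j); case: (@fintype.split 1 n j) => l /=.
  by rewrite (ord1 l) (cons_row0 (a, v)).
by rewrite (cons_rowS (a, v)); have := hv ord0 l; rewrite [rsubmx z _ _]mxE; exact.
Qed.
End borel_rows.

Section lebesgue_Rn.
Context (R : realType).

Section step.
Variables (n : nat) (m : {sigma_finite_measure set (borelRn R n) -> \bar R}).

Definition lebesgue_step : set (borelRn R n.+1) -> \bar R :=
  pushforward (lebesgue_measure \x m)%E (@cons_row R n).

Let step0 : lebesgue_step set0 = 0%E.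
Proof. by rewrite /lebesgue_step /pushforward preimage_set0 measure0. Qed.

Let step_ge0 A : (0 <= lebesgue_step A)%E.
Proof. by apply: measure_ge0; exact: measurable_cons_row. Qed.

Let step_sigma_additive : semi_sigma_additive lebesgue_step.
Proof.
by apply: measure_semi_sigma_additive; exact: measurable_cons_row.
Qed.

HB.instance Definition _ := isMeasure.Build _ _ _ lebesgue_step
  step0 step_ge0 step_sigma_additive.

Let head (v : borelRn R n.+1) : R := (v : 'rV[R]_(1 + n)) ord0 (lshift n ord0).
Let tail (v : borelRn R n.+1) : borelRn R n := rsubmx (v : 'rV[R]_(1 + n)).

Let measurable_head : measurable_fun setT head.
Proof.
refine (measurability _ (measurable_realfun.RGenOpens.measurableE R) _).
move=> _ [_ [x [y ->]] <-]; rewrite setTI; apply: open_measurableRn.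
have := @coord_continuous R 1 (1 + n) ord0 (lshift n ord0).
by move=> /continuousP; apply; exact: interval_open.
Qed.

Let measurable_tail : measurable_fun setT tail.
Proof.
refine (@measurability _ _ _ _ setT tail (@open 'rV[R]_n) erefl _).
move=> _ [U oU <-]; rewrite setTI; apply: open_measurableRn.
rewrite openE => v /= Uv.
have /nbhs_ballP[e /= e0 eU] : nbhs (tail v : 'rV[R]_n) U.
  exact: open_nbhs_nbhs.
apply/nbhs_ballP; exists e => //= w [_ vw]; apply: eU; split=> // i j.
by rewrite /tail !mxE; exact: vw.
Qed.

Let step_sigma_finite : sigma_finite setT lebesgue_step.
Proof.
have /sigma_finiteP[F [FT ndF Foo]] := sigma_finiteT (@lebesgue_measure R).
have /sigma_finiteP[G [GT ndG Goo]] := sigma_finiteT m.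
exists (fun k => (head @^-1` F k) `&` (tail @^-1` G k)).
  apply/seteqP; split => // v _.
  have [i _ Fi] : (\bigcup_i F i) (head v) by rewrite -FT.
  have [j _ Gj] : (\bigcup_i G i) (tail v) by rewrite -GT.
  exists (maxn i j) => //; split => /=.
    by move: (head v) Fi; exact/subsetPset/ndF/leq_maxl.
  by move: (tail v) Gj; exact/subsetPset/ndG/leq_maxr.
move=> k; have [mF Fk] := Foo k; have [mG Gk] := Goo k; split.
  rewrite -[X in measurable X]setTI setIIr; apply: measurableI.
    exact: measurable_head.
  exact: measurable_tail.
rewrite /lebesgue_step /pushforward (_ : _ @^-1` _ = F k `*` G k).
  by rewrite product_measure1E// lte_mul_pinfty// ge0_fin_numE.
by apply/seteqP; split => -[a v] /=;
  rewrite /head (cons_row0 (a, v)) /tail /cons_row/=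
    (row_mxKr (const_mx a : 'rV_1)).
Qed.

HB.instance Definition _ := Measure_isSigmaFinite.Build _ _ _ lebesgue_step
  step_sigma_finite.

End step.

(* Lebesgue measure on R^n: the n-fold product of the one-dimensional one,
   carried to row vectors by (x, y) |-> row with head x and tail y. *)
Fixpoint lebesgue_Rn (n : nat) :
    {sigma_finite_measure set (borelRn R n) -> \bar R} :=
  if n is n'.+1 then lebesgue_step (lebesgue_Rn n')
  else \d_((0 : 'rV[R]_0) : borelRn R 0).

End lebesgue_Rn.

Section sphere.
Context (R : realType).

(* Euclidean norm; the library's norm `|x| on 'rV[R]_n is the sup norm. *)
Definition enorm n (x : 'rV[R]_n) : R := Num.sqrt (\sum_i x ord0 i ^+ 2).

Definition sphere (d : nat) : set 'rV[R]_d.+1 := [set x | enorm x = 1].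

Lemma continuous_enorm n : continuous (@enorm n).
Proof.
move=> x; rewrite /enorm.
apply: (@continuous_comp _ _ _ (fun y : 'rV[R]_n => \sum_i y ord0 i ^+ 2)).
  apply: (@continuous_big R) => [|i _ {}x]; first exact: add_continuous.
  apply: (@cvg_comp _ _ _ (fun y : 'rV[R]_n => y ord0 i)
    (fun r : R => r ^+ 2)); first exact: coord_continuous.
  exact: exprn_continuous.
exact: sqrt_continuous.
Qed.

Lemma continuous_normalize d (x : 'rV[R]_d.+1) : enorm x != 0 ->
  {for x, continuous (fun y : 'rV[R]_d.+1 => (enorm y)^-1 *: y)}.
Proof.
move=> e0; apply: (@cvgZ R _ _ (nbhs x) _ (fun y => (enorm y)^-1) id).
  by apply: cvgV => //; exact: continuous_enorm.
exact: cvg_id.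
Qed.

(* For A included in the sphere, this is { r y | 0 < r < 1, y in A }. *)
Definition radial_sector d (A : set (borelRn R d.+1)) : set (borelRn R d.+1) :=
  [set x : 'rV[R]_d.+1 | 0 < enorm x < 1 /\ A ((enorm x)^-1 *: x)].

Lemma measurable_radial_sector d (A : set (borelRn R d.+1)) :
  measurable A -> measurable (radial_sector A).
Proof.
pose D : set (borelRn R d.+1) := [set x : 'rV[R]_d.+1 | 0 < enorm x < 1].
have oD : open (D : set 'rV[R]_d.+1).
  have -> : D = (@enorm d.+1) @^-1` (`]0, 1[%classic).
    by apply/seteqP; split => x /=; rewrite in_itv.
  have /continuousP := @continuous_enorm d.+1.
  by apply; exact: interval_open.
have mD : measurable D by exact: open_measurableRn.
suff mf : measurable_fun D
    (fun x => (enorm (x : 'rV[R]_d.+1))^-1 *: (x : 'rV[R]_d.+1) : borelRn R d.+1).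
  by move=> mA; exact: mf.
refine (@measurability _ _ _ (borelRn R d.+1) D _ (@open 'rV[R]_d.+1) erefl _).
move=> _ [U oU <-]; apply: open_measurableRn.
rewrite openE => x [Dx Ux]; apply: filterI.
  exact: open_nbhs_nbhs.
have e0 : enorm (x : 'rV[R]_d.+1) != 0 by case/andP: Dx => /lt0r_neq0.
by apply: (continuous_normalize e0); exact: open_nbhs_nbhs.
Qed.

(* Surface measure of S^d by polar coordinates in R^(d+1): the solid sector over
   A has volume Area(A) * int_0^1 r^d dr = Area(A) / (d+1). It is a Borel
   measure on R^(d+1) that only sees the part of A lying on S^d. *)
Definition surface_measure (d : nat) (A : set (borelRn R d.+1)) : \bar R :=
  (d.+1%:R%:E * lebesgue_Rn R d.+1 (radial_sector A))%E.

Section surface_measure_is_measure.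
Variable d : nat.

Let surface0 : surface_measure (set0 : set (borelRn R d.+1)) = 0%E.
Proof.
rewrite /surface_measure (_ : radial_sector _ = set0) ?measure0 ?mule0//.
by apply/seteqP; split => // x [].
Qed.

Let surface_ge0 (A : set (borelRn R d.+1)) : (0 <= surface_measure A)%E.
Proof. by rewrite mule_ge0// lee_fin. Qed.

Let surface_sigma_additive : semi_sigma_additive (@surface_measure d).
Proof.
move=> F mF tF mUF; rewrite /surface_measure.
rewrite [X in X @ \oo --> _](_ : _ = (fun n => d.+1%:R%:E *
    \sum_(0 <= i < n) lebesgue_Rn R d.+1 (radial_sector (F i)))%E); last first.
  by apply/funext => n; rewrite ge0_sume_distrr.
apply: cvgeZl => //.
rewrite (_ : radial_sector _ = \bigcup_k radial_sector (F k)); last first.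
  apply/seteqP; split => [x [hx [k _ Fk]]|x [k _ [hx Fk]]].
    by exists k.
  by split => //; exists k.
apply: measure_sigma_additive => [k|].
  exact: measurable_radial_sector.
apply/trivIsetP => i j _ _ ij; apply/seteqP; split => // x [[_ Fi] [_ Fj]].
move/trivIsetP : tF => /(_ _ _ I I ij) FF0.
suff : set0 ((enorm (x : 'rV[R]_d.+1))^-1 *: (x : 'rV[R]_d.+1)) by [].
by rewrite -FF0.
Qed.

HB.instance Definition _ := isMeasure.Build _ _ _ (@surface_measure d)
  surface0 surface_ge0 surface_sigma_additive.

End surface_measure_is_measure.

Definition Gamma (x : R) : R :=
  \int[lebesgue_measure]_(t in `]0, +oo[) (t `^ (x - 1) * expR (- t)).

(* Density with respect to the surface measure of S^d. *)
Definition spherical_cauchy (d : nat) (phi y : 'rV[R]_d.+1) : R :=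
  Gamma (d.+1%:R / 2) / (2 * pi `^ (d.+1%:R / 2)) *
  (`|1 - enorm phi ^+ 2| / enorm (y - phi) ^+ 2) ^+ d.

(* M_(I,psi): the orthogonal factor of the general Moebius transformation of the
   sphere is the identity matrix here. The denominator is nonzero for y in S^d
   and psi outside S^d. *)
Definition mobius (d : nat) (psi y : 'rV[R]_d.+1) : 'rV[R]_d.+1 :=
  ((1 - enorm psi ^+ 2) / enorm (y + psi) ^+ 2) *: (y + psi) + psi.

End sphere.

Arguments surface_measure R d A : clear implicits.
Arguments sphere R d _ : clear implicits.

(* Main.v *)
(* Stereographic projection from the axis of phi conjugates the Moebius
   transformation M_(I,-phi) to the dilation w |-> (1 - |phi|) / (1 + |phi|) w
   of R^d, and it carries the surface measure to the density
   (2 / (1 + |w|^2))^d. Comparing the density at w and at its dilate gives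
   Area(M(A)) = int_A (|1 - |phi|^2| / |y - phi|^2)^d dy when phi lies on the
   first coordinate axis; a reflection moves a general phi there, since Lebesgue
   measure is invariant under isometries. The stereographic density comes from
   the coordinates x = (a, v), s = |x| - a, v = s w on R^(d+1), in which the solid
   sector over A is {s < 2 / (1 + |w|^2)}, w in the projection of A. The normalizing constant is 1 / Area(S^d):
   evaluate int exp(-|x|^2) dx once by Fubini and once over balls. *)
From HB Require Import structures.
Require Import Defs.
From mathcomp Require Import all_boot all_order all_algebra.
From mathcomp Require Import all_classical all_reals all_analysis.
From mathcomp Require Import measurable_realfun.
From mathcomp Require Import ring lra.

Set Implicit Arguments.
Unset Strict Implicit.
Unset Printing Implicit Defensive.

Import Order.TTheory GRing.Theory Num.Theory.
Import numFieldNormedType.Exports.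

Local Open Scope classical_set_scope.
Local Open Scope ring_scope.

(** * Integration against image densities *)

(** Every change of variables in R^n is brought down to one variable. Affine maps are treated
    coordinate by coordinate; stereographic coordinates consist of one substitution in [a] for fixed
    [v] and one dilation in [v] for fixed [s], with Tonelli in between. A substitution on the line
    only has to be checked on intervals []a, b]], by uniqueness of Lebesgue measure, so no Jacobian
    determinant ever appears. A reflection mixes coordinates and escapes this scheme, which is why
    its invariance needs an argument of its own, based on translation invariance. Integrands are
    nonnegative with values in [\bar R], so exchanging integrals requires no integrability; that the
    volume of the ball and the Gamma integral are finite is read off afterwards from the Gaussian
    identity. Exceptional points (the axis v = 0, the points off the sphere) are discarded as null
    sets. *)

Section density.
Local Open Scope ereal_scope.
Context d1 d2 (X : measurableType d1) (Y : measurableType d2) (R : realType).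
Variables (m1 : {measure set X -> \bar R}) (m2 : {measure set Y -> \bar R}).
Variables (h : Y -> X) (p : Y -> R).
Hypotheses (mh : measurable_fun setT h) (mp : measurable_fun setT p).
Hypothesis p0 : forall y, (0 <= p y)%R.
Hypothesis m1E : forall A, measurable A -> m1 A = \int[m2]_(y in h @^-1` A) (p y)%:E.

Import HBNNSimple.

(** Hypothesis [m1E] makes [m1] the image under [h] of the measure with density [p]. It passes from
    sets to simple functions by linearity, then to [g] by monotone convergence. It serves both for
    substitutions on the line and for the surface measure. *)
Lemma ge0_integral_density (g : X -> \bar R) :
  measurable_fun setT g -> (forall x, 0 <= g x) ->
  \int[m1]_x g x = \int[m2]_y (g (h y) * (p y)%:E).
Proof.
move=> mg g0.
pose f_ := nnsfun_approx measurableT mg.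
have mf n : measurable_fun setT (fun y => (f_ n (h y))%:E).
  by apply/measurable_EFinP; exact: measurableT_comp.
have mpE : measurable_fun setT (fun y => (p y)%:E) by exact/measurable_EFinP.
transitivity (limn (fun n => \int[m1]_x (f_ n x)%:E)).
  rewrite -monotone_convergence//.
  - apply: eq_integral => y _; apply/esym/cvg_lim => //.
    by apply: cvg_nnsfun_approx.
  - by move=> n; exact/measurable_EFinP.
  - by move=> n y _; rewrite lee_fin.
  - by move=> y _ m n mn; rewrite lee_fin; exact/lefP/nd_nnsfun_approx.
rewrite [X in limn X](_ : _ = (fun n => \int[m2]_y ((f_ n (h y))%:E * (p y)%:E))).
  rewrite -monotone_convergence//.
  - apply: eq_integral => y _; apply/cvg_lim => //.
    by apply: cvgeZr => //; apply: cvg_nnsfun_approx.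
  - by move=> n; apply: emeasurable_funM.
  - by move=> n y _; rewrite mule_ge0// lee_fin.
  - move=> y _ m n mn; apply: lee_wpmul2r; rewrite lee_fin//.
    by have /lefP := nd_nnsfun_approx measurableT mg mn; exact.
apply/funext => n.
have mfh r : measurable (h @^-1` (f_ n @^-1` [set r])).
  by rewrite -[X in measurable X]setTI; exact/mh.
have mfpi r : measurable_fun setT
    (fun y => (r * \1_(f_ n @^-1` [set r]) (h y))%:E).
  apply/measurable_EFinP; apply: measurable_funM => //.
  exact: measurableT_comp.
transitivity (\sum_(k \in range (f_ n))
    \int[m1]_x (k * \1_(f_ n @^-1` [set k]) x)%:E).
  under eq_integral do rewrite fimfunE -fsumEFin//.
  rewrite ge0_integral_fsum//.
  - by move=> y; apply/measurable_EFinP/measurable_funM.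
  - by move=> y x _; rewrite EFinM nnfun_muleindic_ge0.
transitivity (\sum_(k \in range (f_ n))
    \int[m2]_y ((k * \1_(f_ n @^-1` [set k]) (h y))%:E * (p y)%:E)); last first.
  rewrite -ge0_integral_fsum//.
  - apply: eq_integral => y _; rewrite fimfunE -fsumEFin//.
    by rewrite ge0_mule_fsuml// => r; rewrite EFinM nnfun_muleindic_ge0.
  - by move=> r; apply: emeasurable_funM.
  - by move=> r y _; apply: mule_ge0; rewrite ?EFinM ?nnfun_muleindic_ge0 ?lee_fin.
apply: eq_fsbigr => r; rewrite inE => -[x _ <-].
have r0 : (0 <= f_ n x)%R by [].
move: (f_ n x) r0 => k k0.
under eq_integral do rewrite EFinM.
rewrite ge0_integralZl//; last exact/measurable_EFinP.
rewrite integral_indic// setIT m1E//.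
under [RHS]eq_integral do rewrite EFinM -muleA.
rewrite ge0_integralZl//; last 2 first.
- apply: emeasurable_funM => //; apply/measurable_EFinP.
  exact: measurableT_comp.
- by move=> y _; apply: mule_ge0; rewrite lee_fin.
congr (_ * _); rewrite integral_mkcond; apply: eq_integral => y _.
rewrite patchE indicE /=.
have -> : (y \in (h @^-1` (f_ n @^-1` [set k]))) = (h y \in (f_ n @^-1` [set k])).
  by apply/idP/idP; rewrite !inE.
by case: ifP; rewrite ?mul1e ?mul0e.
Qed.

End density.

Section lebesgue_change_of_variables.
Local Open Scope ereal_scope.
Context (R : realType) (h p : R -> R).
Hypotheses (mh : measurable_fun setT h) (mp : measurable_fun setT p).
Hypothesis p0 : forall t, (0 <= p t)%R.
Local Notation mu := (@lebesgue_measure R).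

Let nu (A : set (measurableTypeR R)) := \int[mu]_(t in h @^-1` A) (p t)%:E.

Let nu0 : nu set0 = 0.
Proof. by rewrite /nu preimage_set0 integral_set0. Qed.

Let nu_ge0 A : 0 <= nu A.
Proof. by apply: integral_ge0 => t _; rewrite lee_fin. Qed.

Let nu_sigma_additive : semi_sigma_additive nu.
Proof.
move=> F mF tF mUF; rewrite /nu preimage_bigcup.
have mhF k : measurable (h @^-1` F k)
  by rewrite -[X in measurable X]setTI; exact: (mh measurableT (mF k)).
apply: (@semi_sigma_additive_nng_induced _ _ _ mu (EFin \o p)) => //=.
- exact/measurable_EFinP.
- apply/trivIsetP => i j _ _ ij; rewrite -preimage_setI.
  by move/trivIsetP : tF => /(_ _ _ _ _ ij) ->//; rewrite preimage_set0.
- exact: bigcupT_measurable mhF.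
Qed.

HB.instance Definition _ := isMeasure.Build _ _ _ nu nu0 nu_ge0 nu_sigma_additive.

(** The set function [nu] is a measure that agrees with Lebesgue measure on half-open intervals,
    hence on all Borel sets; the density lemma then applies. *)
Lemma ge0_integral_lebesgue_substitution (g : R -> \bar R) :
  (forall a b, (a < b)%R ->
    \int[mu]_(t in h @^-1` `]a, b]) (p t)%:E = (b - a)%:E) ->
  measurable_fun setT g -> (forall x, 0 <= g x) ->
  \int[mu]_x g x = \int[mu]_t (g (h t) * (p t)%:E).
Proof.
move=> hp mg g0; apply: ge0_integral_density => // A mA.
apply: (@lebesgue_measure_unique _ nu) => // _ [[a b] _ <-] /=.
rewrite lebesgue_measure_itv/= lte_fin; case: ltP => [ab|ba].
  by rewrite /nu hp.
by rewrite set_itv_ge ?measure0// -leNgt.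
Qed.

End lebesgue_change_of_variables.

Section affine.
Local Open Scope ereal_scope.
Context (R : realType).
Local Notation mu := (@lebesgue_measure R).

Lemma ge0_integral_lebesgue_affine (c b : R) (g : R -> \bar R) : c != 0%R ->
  measurable_fun setT g -> (forall x, 0 <= g x) ->
  \int[mu]_x g x = `|c|%:E * \int[mu]_x g (c * x + b)%R.
Proof.
move=> c0 mg g0.
have mh : measurable_fun setT (fun x => c * x + b)%R.
  by apply: measurable_funD => //; exact: measurable_funM.
rewrite (@ge0_integral_lebesgue_substitution R (fun x => c * x + b)%R (cst `|c|)%R)//; last first.
  move=> x y xy; rewrite [LHS](@integral_cst _ _ _ mu _ _ `|c|%:E); last first.
    by rewrite -[X in measurable X]setTI; exact: mh.
  have [cgt|clt|c00] := ltgtP c 0%R; last by rewrite c00 eqxx in c0.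
  (* A negative slope reverses the interval, so the closed end moves to the left. *)
  - rewrite (_ : _ @^-1` _ = `[((y - b) / c)%R, ((x - b) / c)%R[%classic).
      rewrite /= lebesgue_measure_itv/= lte_fin ltr_nM2r ?invr_lt0// ltrD2r xy.
      rewrite -EFinB -EFinM ltr0_norm//; congr EFin; field; lra.
    apply/seteqP; split => t /=; rewrite !in_itv/= ler_ndivrMr// ltr_ndivlMr//;
      move=> /andP[? ?]; apply/andP; split; lra.
  - rewrite (_ : _ @^-1` _ = `]((x - b) / c)%R, ((y - b) / c)%R]%classic).
      rewrite /= lebesgue_measure_itv/= lte_fin ltr_pM2r ?invr_gt0// ltrD2r xy.
      rewrite -EFinB -EFinM gtr0_norm//; congr EFin; field; lra.
    apply/seteqP; split => t /=; rewrite !in_itv/= ler_pdivlMr// ltr_pdivrMr//;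
      move=> /andP[? ?]; apply/andP; split; lra.
rewrite -ge0_integralZl//.
- by apply: eq_integral => x _; rewrite muleC.
- exact: measurableT_comp.
Qed.

End affine.

(** * Lebesgue measure on row vectors *)

Section measurability.
Context (R : realType).

(** Writing 1/x as x times (x^2)^(-1) brings in a real power of a nonnegative base, which is known
    to be measurable. At x = 0 both sides are 0. *)
Lemma measurable_funV d (T : measurableType d) (f : T -> R) :
  measurable_fun setT f -> measurable_fun setT (fun t => (f t)^-1).
Proof.
move=> mf; rewrite (_ : (fun t => _) = (fun t => f t * (f t ^+ 2) `^ (-1))).
  apply: measurable_funM => //.
  apply: (measurableT_comp (measurable_powR (-1))).
  exact: measurable_funX.
apply/funext => t; rewrite powR_inv1 ?sqr_ge0//.
have [->|ft0] := eqVneq (f t) 0; first by rewrite invr0 mul0r.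
by field.
Qed.

Lemma measurable_coord n (i : 'I_n) :
  measurable_fun setT (fun x : borelRn R n => (x : 'rV[R]_n) ord0 i).
Proof.
refine (measurability _ (RGenOpens.measurableE R) _).
move=> _ [_ [x [y ->]] <-]; rewrite setTI; apply: open_measurableRn.
have := @coord_continuous R 1 n ord0 i.
by move=> /continuousP; apply; exact: interval_open.
Qed.

(** An open set is a countable union of rational balls, and a ball of the sup norm is a finite
    intersection of conditions on single coordinates. *)
Lemma measurable_fun_row d (T : measurableType d) n (f : T -> borelRn R n) :
  (forall i, measurable_fun setT (fun t => (f t : 'rV[R]_n) ord0 i)) ->
  measurable_fun setT f.
Proof.
move=> mf; refine (@measurability _ _ _ _ setT f (@open 'rV[R]_n) erefl _).
move=> _ [U oU <-]; rewrite setTI (open_bigcup_balls oU) preimage_bigcup.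
apply: countable_bigcupT_measurable => // -[q k] /=.
case: ifPn => _; last by rewrite preimage_set0.
set z : 'rV[R]_n := map_mx _ q; set r := _^-1.
rewrite (_ : _ @^-1` _ =
    \bigcap_(i in [set: 'I_n])
      ((fun t => (f t : 'rV[R]_n) ord0 i) @^-1` ball (z ord0 i) r)).
  apply: fin_bigcap_measurable => [|i _]; first exact: finite_finset.
  rewrite -[X in measurable X]setTI; apply: mf => //.
  exact: measurable_ball.
apply/seteqP; split => t /=.
  by move=> [r0 h] i _; exact: h.
move=> h; split => [|i j]; first by rewrite invr_gt0.
by rewrite ord1; exact: h.
Qed.

Definition dot n (x y : 'rV[R]_n) : R := \sum_i x ord0 i * y ord0 i.

Lemma measurable_fun_sum_fin d (T : measurableType d) (I : finType) (h : I -> T -> R) :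
  (forall i, measurable_fun setT (h i)) ->
  measurable_fun setT (fun t => \sum_i h i t).
Proof. by move=> mh; exact: measurable_sum. Qed.

Lemma measurable_dot d (T : measurableType d) n (f g : T -> borelRn R n) :
  measurable_fun setT f -> measurable_fun setT g ->
  measurable_fun setT (fun t => dot (f t) (g t)).
Proof.
move=> mf mg; apply: measurable_fun_sum_fin => i; apply: measurable_funM.
  exact: (measurableT_comp (measurable_coord i) mf).
exact: (measurableT_comp (measurable_coord i) mg).
Qed.

Lemma measurable_addrow d (T : measurableType d) n (f g : T -> borelRn R n) :
  measurable_fun setT f -> measurable_fun setT g ->
  measurable_fun setT (fun t => (f t : 'rV[R]_n) + g t : borelRn R n).
Proof.
move=> mf mg; apply: measurable_fun_row => i.
under eq_fun do rewrite mxE.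
apply: measurable_funD.
  exact: (measurableT_comp (measurable_coord i) mf).
exact: (measurableT_comp (measurable_coord i) mg).
Qed.

Lemma measurable_scalerow d (T : measurableType d) n
    (c : T -> R) (f : T -> borelRn R n) :
  measurable_fun setT c -> measurable_fun setT f ->
  measurable_fun setT (fun t => c t *: (f t : 'rV[R]_n) : borelRn R n).
Proof.
move=> mc mf; apply: measurable_fun_row => i.
under eq_fun do rewrite mxE.
apply: measurable_funM => //.
exact: (measurableT_comp (measurable_coord i) mf).
Qed.

Lemma enormE n (x : 'rV[R]_n) : enorm x = Num.sqrt (dot x x).
Proof. by rewrite /enorm /dot; congr Num.sqrt; apply: eq_bigr => i _; rewrite expr2. Qed.

Lemma dot_ge0 n (x : 'rV[R]_n) : 0 <= dot x x.
Proof. by apply: sumr_ge0 => i _; rewrite -expr2 sqr_ge0. Qed.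

Lemma enorm_ge0 n (x : 'rV[R]_n) : 0 <= enorm x.
Proof. exact: sqrtr_ge0. Qed.

Lemma sqr_enorm n (x : 'rV[R]_n) : enorm x ^+ 2 = dot x x.
Proof. by rewrite enormE sqr_sqrtr// dot_ge0. Qed.

Lemma dotC n (x y : 'rV[R]_n) : dot x y = dot y x.
Proof. by apply: eq_bigr => i _; rewrite mulrC. Qed.

Lemma dotDl n (x y z : 'rV[R]_n) : dot (x + y) z = dot x z + dot y z.
Proof. by rewrite /dot -big_split; apply: eq_bigr => i _; rewrite mxE mulrDl. Qed.

Lemma dotZl n c (x z : 'rV[R]_n) : dot (c *: x) z = c * dot x z.
Proof. by rewrite /dot mulr_sumr; apply: eq_bigr => i _; rewrite mxE mulrA. Qed.

Lemma dotNl n (x z : 'rV[R]_n) : dot (- x) z = - dot x z.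
Proof. by rewrite -scaleN1r dotZl mulN1r. Qed.

Lemma dotDr n (x y z : 'rV[R]_n) : dot z (x + y) = dot z x + dot z y.
Proof. by rewrite dotC dotDl !(dotC _ z). Qed.

Lemma dotZr n c (x z : 'rV[R]_n) : dot z (c *: x) = c * dot z x.
Proof. by rewrite dotC dotZl dotC. Qed.

Lemma dotNr n (x z : 'rV[R]_n) : dot z (- x) = - dot z x.
Proof. by rewrite dotC dotNl dotC. Qed.

Definition dotE := (dotDl, dotDr, dotNl, dotNr, dotZl, dotZr).

Lemma dot_eq0 n (x : 'rV[R]_n) : (dot x x == 0) = (x == 0).
Proof.
apply/eqP/eqP => [|->]; last by rewrite /dot big1// => i _; rewrite mxE mul0r.
move=> /eqP; rewrite psumr_eq0 => [/allP h|i _]; last by rewrite -expr2 sqr_ge0.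
apply/rowP => i; rewrite mxE; apply/eqP.
by have /implyP/(_ isT) := h i (mem_index_enum _); rewrite mulf_eq0 orbb.
Qed.

Lemma enorm_eq0 n (x : 'rV[R]_n) : (enorm x == 0) = (x == 0).
Proof. by rewrite -dot_eq0 -sqr_enorm expf_eq0. Qed.

Lemma enormZ n c (x : 'rV[R]_n) : enorm (c *: x) = `|c| * enorm x.
Proof.
rewrite !enormE dotZl dotZr mulrA -expr2 sqrtrM ?sqr_ge0//.
by rewrite sqrtr_sqr.
Qed.

Lemma measurable_enorm d (T : measurableType d) n (f : T -> borelRn R n) :
  measurable_fun setT f -> measurable_fun setT (fun t => enorm (f t)).
Proof.
move=> mf; under eq_fun do rewrite enormE.
apply: measurableT_comp; last exact: measurable_dot.
by apply: continuous_measurable_fun; exact: sqrt_continuous.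
Qed.

Lemma measurable_normalize n : measurable_fun setT
  (fun x : borelRn R n => (enorm (x : 'rV[R]_n))^-1 *: (x : 'rV[R]_n) : borelRn R n).
Proof.
apply: measurable_scalerow => //; apply: measurable_funV; exact: measurable_enorm.
Qed.

Lemma dot_cons_row n a b (v w : 'rV[R]_n) :
  dot (cons_row (a, v : borelRn R n) : 'rV[R]_n.+1) (cons_row (b, w : borelRn R n)) =
  a * b + dot v w.
Proof.
rewrite /dot (@big_split_ord _ _ _ 1 n) big_ord1 !cons_row0; congr (_ + _).
by apply: eq_bigr => i _; rewrite !cons_rowS.
Qed.

Lemma cons_row_surj n (x : 'rV[R]_n.+1) :
  x = cons_row (x ord0 ord0, (rsubmx (x : 'rV[R]_(1 + n)) : borelRn R n)).
Proof.
apply/rowP => j; rewrite -(@splitK 1 n j).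
case: (@fintype.split 1 n j) => l /=; last by rewrite cons_rowS mxE.
by rewrite (ord1 l) cons_row0; congr (x _ _); exact: val_inj.
Qed.

Lemma cons_rowD n a b (v w : 'rV[R]_n) :
  (cons_row (a, v : borelRn R n) : 'rV[R]_n.+1) + cons_row (b, w : borelRn R n) =
  cons_row (a + b, (v + w : borelRn R n)).
Proof.
apply/rowP => j; rewrite -(@splitK 1 n j) [LHS]mxE.
case: (@fintype.split 1 n j) => l /=; last by rewrite !cons_rowS mxE.
by rewrite (ord1 l) !cons_row0.
Qed.

Lemma cons_rowZ n c a (v : 'rV[R]_n) :
  c *: (cons_row (a, v : borelRn R n) : 'rV[R]_n.+1) =
  cons_row (c * a, (c *: v : borelRn R n)).
Proof.
apply/rowP => j; rewrite -(@splitK 1 n j) [LHS]mxE.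
case: (@fintype.split 1 n j) => l /=; last by rewrite !cons_rowS mxE.
by rewrite (ord1 l) !cons_row0.
Qed.

End measurability.

Section integral_Rn.
Local Open Scope ereal_scope.
Context (R : realType).
Local Notation mu := (@lebesgue_measure R).

Lemma ge0_integral_lebesgue_RnS n (G : borelRn R n.+1 -> \bar R) :
  measurable_fun setT G -> (forall x, 0 <= G x) ->
  \int[lebesgue_Rn R n.+1]_x G x = \int[lebesgue_Rn R n]_v \int[mu]_a G (cons_row (a, v)).
Proof.
move=> mG G0 /=; rewrite ge0_integral_pushforward//; last exact: measurable_cons_row.
rewrite preimage_setT fubini_tonelli2//; last by move=> x; exact: G0.
by apply: measurableT_comp => //; exact: measurable_cons_row.
Qed.

Lemma measurable_cons_row_l n (v : borelRn R n) :
  measurable_fun setT (fun a : R => cons_row (a, v)).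
Proof.
apply: (measurableT_comp (@measurable_cons_row R n)).
exact: measurable_fun_pair.
Qed.

Lemma measurable_integral_cons_row n (G : borelRn R n.+1 -> \bar R) :
  measurable_fun setT G -> (forall x, 0 <= G x) ->
  measurable_fun setT (fun v => \int[mu]_a G (cons_row (a, v))).
Proof.
move=> mG G0.
have mGc := measurableT_comp mG (@measurable_cons_row R n).
apply: (@measurable_fun_fubini_tonelli_G _ _ _ _ R mu (G \o @cons_row R n)) => // x; exact: G0.
Qed.

(** Induction on the dimension: the tail is handled by the induction hypothesis and the head
    coordinate by the affine substitution on the line, each coordinate contributing one factor
    [|c|]. *)
Lemma ge0_integral_lebesgue_Rn_affine n (c : R) (b : 'rV[R]_n)
    (G : borelRn R n -> \bar R) : c != 0%R ->
  measurable_fun setT G -> (forall x, 0 <= G x) ->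
  \int[lebesgue_Rn R n]_x G x =
  (`|c| ^+ n)%:E *
    \int[lebesgue_Rn R n]_x G ((c *: (x : 'rV[R]_n) + b)%R : borelRn R n).
Proof.
move=> c0; elim: n b G => [|n IH] b G mG G0.
  rewrite /= expr0 mul1e; apply: eq_integral => x _; congr (G _).
  by apply/rowP => -[].
have maff m (b' : 'rV[R]_m) : measurable_fun setT
    (fun x : borelRn R m => (c *: (x : 'rV[R]_m) + b')%R : borelRn R m).
  apply: (@measurable_addrow _ _ _ _ _ (cst b')) => //.
  exact: (@measurable_scalerow _ _ _ _ (cst c)).
have mGb := measurableT_comp mG (maff _ b).
rewrite !ge0_integral_lebesgue_RnS//.
pose b0 : R := b ord0 ord0; pose b1 : 'rV[R]_n := rsubmx (b : 'rV_(1 + n)).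
rewrite (IH b1); last 2 first.
- exact: measurable_integral_cons_row.
- by move=> v; apply: integral_ge0 => a _; exact: G0.
rewrite exprSr EFinM -muleA; congr (_ * _).
rewrite -ge0_integralZl//; last 2 first.
- by apply: (measurable_integral_cons_row mGb) => x; exact: G0.
- by move=> v _; apply: integral_ge0 => a _; exact: G0.
apply: eq_integral => v _.
rewrite (@ge0_integral_lebesgue_affine R c b0)//; last first.
  apply: measurableT_comp => //; exact: measurable_cons_row_l.
congr (_ * _); apply: eq_integral => a _; congr (G _).
by rewrite cons_rowZ [in RHS](cons_row_surj b) cons_rowD.
Qed.

End integral_Rn.

(** * Gamma function, Gaussian integral and volume of the ball *)

Section one_dim_integrals.
Local Open Scope ereal_scope.
Context (R : realType).
Local Notation mu := (@lebesgue_measure R).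

Lemma integral_expRN_tail (r : R) :
  \int[mu]_(t in `[r, +oo[) (expR (- t))%:E = (expR (- r))%:E.
Proof.
have dE (x : R) : is_derive x (1 : R)%R (fun t => - expR (- t))%R (expR (- x)).
  by apply: is_derive_eq; rewrite mulrN1 opprK.
have cE : continuous (fun t : R => expR (- t)).
  move=> x; apply: continuous_comp; [exact: opp_continuous|exact: continuous_expR].
rewrite (@ge0_continuous_FTC2y _ _ (fun t => - expR (- t))%R _ 0%R)//.
- by rewrite sub0e -EFinN opprK.
- exact: continuous_subspaceT.
- rewrite -oppr0; apply: cvgN; exact: cvgr_expR.
- by apply: cvgN; apply/cvg_at_right_filter; exact: cE.
- by move=> x _; rewrite derive1E; apply: derive_val.
Qed.

Lemma integral_powR (a t : R) : (1 <= a)%R -> (0 < t)%R ->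
  \int[mu]_(s in `]0%R, t[) (a * s `^ (a - 1))%:E = (t `^ a)%:E.
Proof.
move=> a1 t0.
have rcvg b : (0 <= b)%R -> (fun x => x `^ b)%R @ (0:R)^'+ --> (0 `^ b : R)%R.
  rewrite le_eqVlt => /predU1P[<-|b0].
    rewrite powRr0; under eq_fun do rewrite powRr0; exact: cvg_cst.
  by rewrite powR0 ?gt_eqF//; exact: powR_cvg0.
have dP b x : (0 < x)%R -> derivable (fun x : R => x `^ b)%R x 1.
  by move=> x0; apply: derivable_powR; rewrite in_itv/= x0.
have cP b x : (0 < x)%R -> {for x, continuous (fun x : R => x `^ b)%R}.
  by move=> x0; apply/differentiable_continuous/derivable1_diffP/dP.
have cf : {within `[0%R, t], continuous (fun s => a * s `^ (a - 1))%R}.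
  apply: derivable_oo_LRcontinuous_within; split.
  - move=> x; rewrite in_itv/= => /andP[x0 _].
    by apply: derivableM => //; exact: dP.
  - by apply: cvgM; [exact: cvg_cst|apply: rcvg; rewrite subr_ge0].
  - by apply: cvgM; [exact: cvg_cst|apply/cvg_at_left_filter; exact: cP].
have mf D : measurable_fun D (fun s => (a * s `^ (a - 1))%:E).
  apply/measurable_EFinP/measurable_funTS/measurable_funM => //.
rewrite integral_itv_bndo_bndc// integral_itv_obnd_cbnd//.
rewrite (@continuous_FTC2 _ _ (fun x => x `^ a)%R)//.
- by rewrite powR0 ?sube0// gt_eqF// (lt_le_trans _ a1).
- split.
  - by move=> x; rewrite in_itv/= => /andP[x0 _]; exact: dP.
  - by apply: rcvg; exact: le_trans a1.
  - by apply/cvg_at_left_filter; exact: cP.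
- move=> x; rewrite in_itv/= => /andP[x0 _].
  by rewrite powR_derive1// in_itv/= x0.
Qed.

End one_dim_integrals.

(** This is the radial sector over the whole sphere; the origin is left out because it has no
    direction. *)
Definition punctured_ball (R : realType) (n : nat) : set (borelRn R n) :=
  [set x : 'rV[R]_n | 0 < enorm x < 1].
Arguments punctured_ball : clear implicits.

Section gaussian.
Local Open Scope ereal_scope.
Context (R : realType).
Local Notation mu := (@lebesgue_measure R).

Lemma integral_mkindic d (T : measurableType d) (m : {measure set T -> \bar R})
    (D : set T) (f : T -> R) :
  \int[m]_(x in D) (f x)%:E = \int[m]_x (f x * \1_D x)%:E.
Proof.
rewrite integral_mkcond; apply: eq_integral => x _; rewrite patchE indicE.
by case: ifP => _; rewrite ?mulr1 ?mulr0.
Qed.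

Lemma measurable_set_ltr d (T : measurableType d) (f g : T -> R) :
  measurable_fun setT f -> measurable_fun setT g ->
  measurable [set t | (f t < g t)%R].
Proof.
move=> mf mg; rewrite (_ : mkset _ = (g \- f)%R @^-1` `]0%R, +oo[).
  rewrite -[X in measurable X]setTI; apply: measurable_funB => //.
by apply/seteqP; split => t /=; rewrite in_itv/= andbT subr_gt0.
Qed.

(** The functional equation Gamma(a + 1) = a Gamma(a), between extended reals since finiteness is
    not yet known. Instead of integrating by parts, t^a is written as the integral of a s^(a-1) over
    0 < s < t and the integrals are exchanged; the integral of exp(-t) over t > s gives back
    exp(-s). *)
Lemma Gamma_succ (a : R) : (1 <= a)%R ->
  \int[mu]_(t in `]0%R, +oo[) (t `^ a * expR (- t))%:E =
  a%:E * \int[mu]_(t in `]0%R, +oo[) (t `^ (a - 1) * expR (- t))%:E.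
Proof.
move=> a1; have a0 : (0 <= a)%R by exact: le_trans a1.
pose S : set (R * R) := [set z | (0 < z.2)%R] `&` [set z | (z.2 < z.1)%R].
have mS : measurable S by apply: measurableI; exact: measurable_set_ltr.
pose F (z : R * R) : \bar R :=
  (a * z.2 `^ (a - 1) * expR (- z.1) * \1_S z)%:E.
have mexpN : measurable_fun setT (fun t : R => expR (- t)).
  by apply: measurableT_comp => //; exact: measurable_expR.
have mpow b : measurable_fun setT (fun t : R => t `^ b)%R.
  exact: measurable_powR.
have mF : measurable_fun setT F.
  apply/measurable_EFinP; apply: measurable_funM; last exact: measurable_indic.
  apply: measurable_funM; last exact: (measurableT_comp mexpN).
  apply: measurable_funM => //; exact: (measurableT_comp (mpow _)).
have F0 z : 0 <= F z.
  by rewrite lee_fin !mulr_ge0 ?expR_ge0 ?powR_ge0.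
transitivity (\int[mu]_t \int[mu]_s F (t, s)).
  rewrite integral_mkcond; apply: eq_integral => t _; rewrite patchE.
  case: ifPn => [|nt]; last first.
    rewrite integral0_eq// => s _; rewrite /F indicE memNset ?mulr0// => -[/= s0 st].
    by move: nt; rewrite mem_set//= in_itv/= (lt_trans s0 st).
  rewrite inE/= in_itv/= andbT => t0.
  rewrite EFinM -(integral_powR a1 t0) integral_mkindic -ge0_integralZr//.
  - apply: eq_integral => s _; rewrite /F -EFinM; congr EFin.
    rewrite -mulrA [in RHS]mulrAC mulrA; congr (_ * _ * _)%R.
    by rewrite !indicE; congr ((_ : bool)%:R); apply/idP/idP;
      rewrite !inE/= in_itv/= => /andP.
  - apply/measurable_EFinP/measurable_funM; last exact: measurable_indic.
    by apply: measurable_funM.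
  - by move=> s _; rewrite lee_fin !mulr_ge0// powR_ge0.
rewrite fubini_tonelli//.
rewrite -ge0_integralZl//; last 2 first.
- by apply/measurable_EFinP/measurable_funTS/measurable_funM.
- by move=> t _; rewrite lee_fin mulr_ge0 ?powR_ge0 ?expR_ge0.
rewrite [RHS]integral_mkcond; apply: eq_integral => s _; rewrite patchE.
case: ifPn => [|ns]; last first.
  rewrite integral0_eq// => t _; rewrite /F indicE memNset ?mulr0// => -[/= s0 st].
  by move: ns; rewrite mem_set//= in_itv/= s0.
rewrite inE/= in_itv/= andbT => s0.
rewrite [in RHS]EFinM -integral_expRN_tail muleA -EFinM.
rewrite -integral_itv_obnd_cbnd; last first.
  exact/measurable_EFinP/measurable_funTS.
rewrite [in RHS]integral_mkindic -ge0_integralZl//.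
- apply: eq_integral => t _; rewrite /F -EFinM; congr EFin.
  rewrite mulrA; congr (_ * _)%R.
  by rewrite !indicE; congr ((_ : bool)%:R); apply/idP/idP;
    rewrite !inE/= in_itv/= ?andbT// => -[].
- apply/measurable_EFinP/measurable_funM => //; exact: measurable_indic.
- by rewrite lee_fin mulr_ge0 ?powR_ge0.
Qed.

Lemma measurable_expNdot n :
  measurable_fun setT (fun x : borelRn R n => (expR (- dot x x))%:E).
Proof.
apply/measurable_EFinP; apply: measurableT_comp; first exact: measurable_expR.
by apply: measurableT_comp => //; exact: measurable_dot.
Qed.

Lemma integral_lebesgue_Rn_gauss n :
  \int[lebesgue_Rn R n]_x (expR (- dot x x))%:E = (Num.sqrt pi ^+ n)%:E.
Proof.
elim: n => [|n IH].
  rewrite /= integral_dirac//; last exact: measurable_expNdot.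
  by rewrite diracT mul1e /dot big_ord0 oppr0 expR0.
rewrite ge0_integral_lebesgue_RnS; last 2 first.
- exact: measurable_expNdot.
- by move=> x; rewrite lee_fin expR_ge0.
rewrite exprSr EFinM -IH -ge0_integralZr//; last exact: measurable_expNdot.
apply: eq_integral => v _; rewrite -integralT_gauss -ge0_integralZl//; last 2 first.
- by apply/measurable_EFinP; exact: measurable_gauss_fun.
- by move=> x _; rewrite lee_fin gauss_fun_ge0.
apply: eq_integral => a _; rewrite dot_cons_row /gauss_fun -EFinM -expRD; congr (expR _)%:E.
by rewrite expr2 opprD addrC.
Qed.

Lemma measurable_Rn_set0 n : measurable ([set 0%R : 'rV[R]_n] : set (borelRn R n)).
Proof.
rewrite (_ : [set _] = ~` [set x : borelRn R n | (0 < dot (x : 'rV[R]_n) x)%R]).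
  apply: measurableC; apply: measurable_set_ltr => //; exact: measurable_dot.
apply/seteqP; split => x /=; first move=> ->.
  by rewrite /dot big1 ?ltxx// => i _; rewrite mxE mul0r.
by move=> /negP; rewrite -leNgt => x0; apply/eqP; rewrite -dot_eq0 eq_le x0 dot_ge0.
Qed.

(** Each line parallel to the first axis meets the origin in at most the point with head 0. The
    dimension is a successor because in dimension 0 the measure is a Dirac mass at 0. *)
Lemma lebesgue_Rn_set0 n :
  lebesgue_Rn R n.+1 ([set 0%R : 'rV[R]_n.+1] : set (borelRn R n.+1)) = 0.
Proof.
have m0 := @measurable_Rn_set0 n.+1.
rewrite -[X in lebesgue_Rn R n.+1 X]setIT -integral_indic// ge0_integral_lebesgue_RnS; last 2 first.
- by apply/measurable_EFinP; exact: measurable_indic.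
- by move=> x; rewrite lee_fin.
apply: integral0_eq => v _; apply/eqP; rewrite eq_le integral_ge0 ?andbT; last first.
  by move=> a _; rewrite lee_fin.
rewrite -(lebesgue_measure_set1 (0%R : R)) -[X in mu X]setIT -integral_indic//.
apply: ge0_le_integral => //.
- apply/measurable_EFinP; apply: measurableT_comp; last exact: measurable_cons_row_l.
  exact: measurable_indic.
- by apply/measurable_EFinP; exact: measurable_indic.
move=> a _; rewrite lee_fin !indicE.
case: (boolP (_ \in [set 0%R : 'rV[R]_n.+1])) => [|_]; last exact: ler0n.
rewrite inE/= => /(congr1 (fun x : 'rV[R]_(1 + n) => x ord0 (lshift n ord0))).
by rewrite cons_row0 mxE/= => ->; rewrite mem_set.
Qed.

Lemma measurable_punctured_ball n : measurable (punctured_ball R n).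
Proof.
rewrite (_ : punctured_ball R n = [set x : borelRn R n | (0 < enorm x)%R] `&`
    [set x : borelRn R n | (enorm x < 1)%R]).
  apply: measurableI; apply: measurable_set_ltr => //; exact: measurable_enorm.
by apply/seteqP; split => x /=; [move=> /andP|move=> h; apply/andP].
Qed.

Lemma lebesgue_Rn_scale n (c : R) (A B : set (borelRn R n)) : c != 0%R ->
  measurable A -> measurable B ->
  (forall x : 'rV[R]_n, A (c *: x)%R <-> B x) ->
  lebesgue_Rn R n A = (`|c| ^+ n)%:E * lebesgue_Rn R n B.
Proof.
move=> c0 mA mB AB.
rewrite -[X in lebesgue_Rn R n X = _]setIT -integral_indic//.
rewrite (@ge0_integral_lebesgue_Rn_affine _ _ c 0%R)//; last first.
  by apply/measurable_EFinP; exact: measurable_indic.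
rewrite -[X in _ * lebesgue_Rn R n X]setIT -integral_indic//; congr (_ * _).
apply: eq_integral => x _; rewrite addr0 !indicE; congr ((_ : bool)%:R%:E).
by apply/idP/idP; rewrite !inE => /AB.
Qed.

(** Layer-cake formula: exp(-|x|^2) is the integral of exp(-t) over t > |x|^2. After the exchange,
    the slice at t is a punctured ball of radius sqrt t, of volume t^(n/2) times that of the unit
    one. The last integral is Gamma(n/2 + 1). *)
Lemma gauss_volume n : (0 < n)%N ->
  (Num.sqrt pi ^+ n)%:E = lebesgue_Rn R n (punctured_ball R n) *
    \int[mu]_(t in `]0%R, +oo[) (t `^ (n%:R / 2) * expR (- t))%:E.
Proof.
case: n => // n _; set N := n.+1.
have mD := @measurable_punctured_ball N.
pose S : set (borelRn R N * R) := [set z | (0 < enorm (z.1 : 'rV[R]_N))%R] `&`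
  [set z | (dot (z.1 : 'rV[R]_N) z.1 < z.2)%R].
have m1 : measurable_fun setT (fun z : borelRn R N * R => z.1).
  exact: measurable_fst.
have mS : measurable S.
  apply: measurableI; apply: measurable_set_ltr => //; first exact: measurable_enorm.
  exact: measurable_dot.
pose F (z : borelRn R N * R) : \bar R := (expR (- z.2) * \1_S z)%:E.
have mexpN : measurable_fun setT (fun t : R => expR (- t)).
  by apply: measurableT_comp => //; exact: measurable_expR.
have mF : measurable_fun setT F.
  apply/measurable_EFinP; apply: measurable_funM; last exact: measurable_indic.
  exact: (measurableT_comp mexpN).
have F0 z : 0 <= F z by rewrite lee_fin mulr_ge0 ?expR_ge0.
rewrite -integral_lebesgue_Rn_gauss.
(* The two integrands differ at the origin, where the condition [0 < enorm x] in [S] kills [F]; the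
   origin is a null set. *)
transitivity (\int[lebesgue_Rn R N]_x \int[mu]_t F (x, t)).
  apply: ae_eq_integral => //; first exact: measurable_expNdot.
    exact: (@measurable_fun_fubini_tonelli_F _ _ _ _ R mu F).
  exists [set 0%R : 'rV[R]_N]; split; [exact: measurable_Rn_set0|exact: lebesgue_Rn_set0|].
  move=> x /=; apply: contra_notP => /eqP x0 _.
  rewrite -integral_expRN_tail -integral_itv_obnd_cbnd; last first.
    exact/measurable_EFinP/measurable_funTS.
  rewrite integral_mkindic; apply: eq_integral => t _; rewrite /F !indicE.
  congr ((_ * (_ : bool)%:R)%:E); apply/idP/idP; rewrite !inE/= in_itv/= andbT; last by case.
  by split => //=; rewrite lt_neqAle enorm_ge0 eq_sym enorm_eq0 x0.
rewrite fubini_tonelli// -ge0_integralZl//; last 2 first.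
- apply/measurable_EFinP/measurable_funTS/measurable_funM => //.
- by move=> t _; rewrite lee_fin mulr_ge0 ?powR_ge0 ?expR_ge0.
rewrite [RHS]integral_mkcond; apply: eq_integral => t _; rewrite patchE.
case: ifPn => [|nt]; last first.
  rewrite integral0_eq// => x _; rewrite /F indicE memNset ?mulr0// => -[/= s0 st].
  move: nt; rewrite mem_set//= in_itv/= andbT (le_lt_trans _ st)//; exact: dot_ge0.
rewrite inE/= in_itv/= andbT => t0.
pose Dt : set (borelRn R N) := [set x : borelRn R N | (0 < enorm (x : 'rV[R]_N))%R] `&`
  [set x : borelRn R N | (dot (x : 'rV[R]_N) x < t)%R].
have mDt : measurable Dt.
  apply: measurableI; apply: measurable_set_ltr => //; first exact: measurable_enorm.
  exact: measurable_dot.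
transitivity ((expR (- t))%:E * lebesgue_Rn R N Dt).
  rewrite -[X in lebesgue_Rn R N X]setIT -integral_indic// -ge0_integralZl//.
    by apply/measurable_EFinP; exact: measurable_indic.
have st0 : (0 < Num.sqrt t)%R by rewrite sqrtr_gt0.
rewrite (@lebesgue_Rn_scale _ (Num.sqrt t) _ (punctured_ball R N))//; last 2 first.
- by rewrite gt_eqF.
- move=> x; rewrite /Dt /punctured_ball /= enormZ ger0_norm ?sqrtr_ge0//.
  rewrite pmulr_rgt0// -sqr_enorm enormZ ger0_norm ?sqrtr_ge0// exprMn sqr_sqrtr ?ltW//.
  rewrite gtr_pMr// expr_lt1 ?enorm_ge0//.
  by split => [[-> ->]|/andP[]].
rewrite muleA muleC; congr (_ * _); rewrite -EFinM mulrC; congr ((_ * _)%:E).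
rewrite ger0_norm ?sqrtr_ge0// -powR12_sqrt ?ltW// -powR_mulrn ?powR_ge0//.
by rewrite -powRrM mulrC.
Qed.

End gaussian.

(** * Invariance under isometries *)

Section isometry.
Local Open Scope ereal_scope.
Context (R : realType).
Local Notation mu := (@lebesgue_measure R).

(** With the convention 0 * oo = 0, a factor 0 or +oo forces the product to be 0 or +oo. Applied to
    the Gaussian identity, this gives the finiteness and positivity of the ball volume and of the
    Gamma integral. *)
Lemma pos_fin_num_factor (r : R) (x y : \bar R) : (0 < r)%R -> 0 <= x -> 0 <= y ->
  r%:E = x * y -> exists2 s, (0 < s)%R & x = s%:E.
Proof.
move=> r0; case: x => [s| |]//; rewrite ?lee_fin => s0 y0.
  move=> rE; exists s => //; rewrite lt_neqAle s0 andbT; apply/eqP => s00.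
  by move: rE; rewrite -s00 mul0e => -[r00]; rewrite r00 ltxx in r0.
have [->|y00] := eqVneq y 0; first by rewrite mule0 => -[r00]; rewrite r00 ltxx in r0.
by rewrite gt0_mulye// lt0e y00.
Qed.

Lemma volume_punctured_ball_gt0 n : (0 < n)%N ->
  exists2 v, (0 < v)%R & lebesgue_Rn R n (punctured_ball R n) = v%:E.
Proof.
move=> n0; apply: (pos_fin_num_factor _ _ _ (gauss_volume R n0)).
- by rewrite exprn_gt0// sqrtr_gt0 pi_gt0.
- exact: measure_ge0.
- by apply: integral_ge0 => t _; rewrite lee_fin mulr_ge0 ?powR_ge0 ?expR_ge0.
Qed.

Lemma ge0_integral_Rn_translation n (b : 'rV[R]_n) (G : borelRn R n -> \bar R) :
  measurable_fun setT G -> (forall x, 0 <= G x) ->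
  \int[lebesgue_Rn R n]_x G ((x : 'rV[R]_n) + b : borelRn R n)%R =
  \int[lebesgue_Rn R n]_x G x.
Proof.
move=> mG G0; rewrite [RHS](@ge0_integral_lebesgue_Rn_affine _ _ 1%R b)//.
by rewrite normr1 expr1n mul1e; apply: eq_integral => x _; rewrite scale1r.
Qed.

(* With mu the image of Lebesgue measure l under T and D the punctured unit ball,
   exchanging the integrals in int int g(x) 1_D(y - x) dl(y) dmu(x) gives
   l(D) int g dmu = mu(-D) int g dl, and mu(-D) = l(D) as T preserves norms. *)
Lemma ge0_integral_Rn_isometry n (T : 'rV[R]_n -> 'rV[R]_n) (G : borelRn R n -> \bar R) :
  (forall x y, T (x + y) = T x + T y)%R -> involutive T ->
  (forall x, enorm (T x) = enorm x) ->
  measurable_fun setT (T : borelRn R n -> borelRn R n) ->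
  measurable_fun setT G -> (forall x, 0 <= G x) ->
  \int[lebesgue_Rn R n]_x G (T x) = \int[lebesgue_Rn R n]_x G x.
Proof.
(* In dimension 0 the punctured ball is empty and its volume cannot be divided out, so this case is
   settled directly. *)
case: n => [|n] in T G *.
  move=> TD TT Tn mT mG G0; apply: eq_integral => x _; congr (G _).
  by apply/rowP => -[].
move=> TD TT Tn mT mG G0; set N := n.+1 in T G TD TT Tn mT mG G0 *.
have T0 : T 0%R = 0%R by apply/eqP; rewrite -enorm_eq0 Tn enorm_eq0.
have TN x : T (- x)%R = (- T x)%R.
  by apply/eqP; rewrite -addr_eq0 -TD addNr T0.
have [v v0 vE] := @volume_punctured_ball_gt0 N isT.
have enormN (x : 'rV[R]_N) : enorm (- x) = enorm x.
  by rewrite -scaleN1r enormZ normrN1 mul1r.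
pose D := punctured_ball R N.
have mD : measurable D := @measurable_punctured_ball R N.
have DT x : D (T x) <-> D x by rewrite /D /punctured_ball /= Tn.
have DN x : D (- x)%R <-> D x by rewrite /D /punctured_ball /= enormN.
have m1 : measurable_fun setT (fun z : borelRn R N * borelRn R N => z.1).
  exact: measurable_fst.
have m2 : measurable_fun setT (fun z : borelRn R N * borelRn R N => z.2).
  exact: measurable_snd.
have mN d (X : measurableType d) (f : X -> borelRn R N) : measurable_fun setT f ->
    measurable_fun setT (fun x => (- (f x : 'rV[R]_N))%R : borelRn R N).
  move=> mf; rewrite (_ : (fun _ => _) = (fun x => (-1) *: (f x : 'rV[R]_N)))%R.
    exact: (@measurable_scalerow _ _ _ _ (cst (-1)%R)).
  by apply/funext => x; rewrite scaleN1r.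
pose F (z : borelRn R N * borelRn R N) :=
  G (T z.1) * (\1_D (((z.2 : 'rV[R]_N) - T z.1)%R : borelRn R N) : R)%:E.
have mGT : measurable_fun setT (fun x : borelRn R N => G (T x)) by exact: (measurableT_comp mG).
have mTz : measurable_fun setT (fun z : borelRn R N * borelRn R N => (T z.1 : borelRn R N)).
  exact: (measurableT_comp mT).
have mF : measurable_fun setT F.
  apply: emeasurable_funM; first exact: (measurableT_comp mGT).
  apply/measurable_EFinP; apply: (measurableT_comp (measurable_indic mD)).
  by apply: measurable_addrow => //; exact: mN.
have F0 z : 0 <= F z by rewrite mule_ge0// lee_fin.
pose H (z : borelRn R N * borelRn R N) :=
  G ((z.2 : 'rV[R]_N) + T z.1 : borelRn R N)%R * (\1_D z.1 : R)%:E.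
have mH : measurable_fun setT H.
  apply: emeasurable_funM.
    by apply: (measurableT_comp mG); exact: measurable_addrow.
  by apply/measurable_EFinP; exact: (measurableT_comp (measurable_indic mD)).
have H0 z : 0 <= H z by rewrite mule_ge0// lee_fin.
suff : v%:E * \int[lebesgue_Rn R N]_x G (T x) = v%:E * \int[lebesgue_Rn R N]_x G x.
  move=> /(congr1 (fun x => v^-1%:E * x)); rewrite !muleA -EFinM.
  by rewrite mulVf ?gt_eqF// !mul1e.
have iD : \int[lebesgue_Rn R N]_x (\1_D x)%:E = v%:E.
  by rewrite integral_indic// setIT.
have mDE : measurable_fun setT (fun x : borelRn R N => (\1_D x : R)%:E).
  by apply/measurable_EFinP; exact: measurable_indic.
transitivity (\int[lebesgue_Rn R N]_x \int[lebesgue_Rn R N]_y F (x, y)).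
  rewrite -iD muleC -ge0_integralZr//; last by rewrite iD lee_fin ltW.
  apply: eq_integral => x _; rewrite -(ge0_integral_Rn_translation (- T x)%R)//.
  rewrite -ge0_integralZl//.
  apply/measurable_EFinP; apply: (measurableT_comp (measurable_indic mD)).
  by apply: (@measurable_addrow _ _ _ _ _ (cst (- T x)%R)).
rewrite fubini_tonelli//.
(* For fixed y, x is translated by [T y]: since T is an additive involution, T (x + T y) = T x + y,
   and y - T (x + T y) = - T x lies in [D] exactly when x does. *)
transitivity (\int[lebesgue_Rn R N]_y \int[lebesgue_Rn R N]_x H (x, y)).
  apply: eq_integral => y _.
  rewrite -[LHS](ge0_integral_Rn_translation (T y))//; last first.
    by apply: (measurableT_comp mF); exact: measurable_fun_pair.
  apply: eq_integral => x _; rewrite /F /H /= TD TT [in RHS]addrC; congr (_ * _).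
  rewrite opprD addrCA subrr addr0 !indicE; congr ((_ : bool)%:R%:E).
  by apply/idP/idP; rewrite !inE DN DT.
rewrite -fubini_tonelli// -iD muleC -ge0_integralZl//; last first.
  exact: integral_ge0.
apply: eq_integral => x _; rewrite -(ge0_integral_Rn_translation (T x) mG G0).
rewrite -ge0_integralZr//.
by apply: (measurableT_comp mG); exact: (@measurable_addrow _ _ _ _ _ (cst (T x))).
Qed.

End isometry.

(** * Stereographic coordinates *)

Section hyperbola_substitution.
Local Open Scope ereal_scope.
Context (R : realType) (c : R).
Hypothesis c0 : (0 < c)%R.
Local Notation mu := (@lebesgue_measure R).

(** On s > 0, [h] decreases from +oo to -oo, with inverse [sigma] and with [q] = -h'. The conjugate
    [tau a] equals c / sigma a. *)
Let h (s : R) := ((c / s - s) / 2)%R.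
Let q (s : R) := ((c / s ^+ 2 + 1) / 2)%R.
Let sigma (a : R) := (Num.sqrt (a ^+ 2 + c) - a)%R.
Let tau (a : R) := (Num.sqrt (a ^+ 2 + c) + a)%R.

Let ltr_norm_sqrt a : (`|a| < Num.sqrt (a ^+ 2 + c))%R.
Proof. by rewrite -sqrtr_sqr ltr_sqrt ?ltrDl// ltr_wpDl ?sqr_ge0. Qed.

Let sigma_gt0 a : (0 < sigma a)%R.
Proof. by rewrite subr_gt0 (le_lt_trans (ler_norm a)). Qed.

Let tau_gt0 a : (0 < tau a)%R.
Proof. by have := ltr_norm_sqrt a; rewrite ltr_norml /tau => /andP[]; lra. Qed.

Let sigma_tau a : (sigma a * tau a = c)%R.
Proof.
rewrite /sigma /tau -subr_sqr sqr_sqrtr ?addr_ge0 ?sqr_ge0 ?ltW//; ring.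
Qed.

(** The factorization shows that h s - a has the sign of sigma a - s, which gives monotonicity and
    inversion at once. *)
Let hB a s : (0 < s)%R -> (h s - a = (sigma a - s) * (tau a + s) / (2 * s))%R.
Proof.
move=> s0; rewrite /h -{1}(sigma_tau a).
have : a = ((tau a - sigma a) / 2)%R by rewrite /tau /sigma; field.
move: (sigma _) (tau _) => x y ->; field.
by rewrite gt_eqF.
Qed.

Let h_gt a s : (0 < s)%R -> (a < h s)%R = (s < sigma a)%R.
Proof.
move=> s0; rewrite -subr_gt0 hB// pmulr_lgt0; last by rewrite invr_gt0 mulr_gt0.
by rewrite pmulr_lgt0 ?subr_gt0// addr_gt0.
Qed.

Let h_sigma a : h (sigma a) = a.
Proof. by apply/eqP; rewrite -subr_eq0 hB// subrr !mul0r. Qed.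

Let is_derive_h (s : R) : (0 < s)%R -> is_derive s (1 : R)%R (fun s => - h s)%R (q s).
Proof.
move=> s0; have sn0 : s != 0%R by rewrite gt_eqF.
have dV := @is_deriveV R id s 1%R 1%R sn0 (is_derive_id _ _).
have dd := is_deriveZ 2^-1%R (is_deriveB (is_derive_id s (1 : R)%R) (is_deriveZ c dV)).
have -> : (fun s => - h s)%R = (2^-1 \*: (id - (c \*: (fun t : R => t^-1))))%R.
  apply/funext => t; transitivity (2^-1 * (t - c * t^-1))%R; [rewrite /h; lra|by []].
by apply: (is_derive_eq dd); rewrite /q /GRing.scale /=; field.
Qed.

(* With c = |v|^2, s > 0 and a = (c / s - s) / 2 one has s = |(a, v)| - a. *)
Lemma ge0_integral_hyperbola (g : R -> \bar R) :
  measurable_fun setT g -> (forall x, 0 <= g x) ->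
  \int[mu]_a g a =
  \int[mu]_(s in `]0%R, +oo[) (g ((c / s - s) / 2)%R * ((c / s ^+ 2 + 1) / 2)%:E).
Proof.
move=> mg g0.
have mid : measurable_fun setT (fun s : R => s) by [].
have mh : measurable_fun setT h.
  apply: measurable_funM => //; apply: measurable_funB => //.
  by apply: measurable_funM => //; exact: measurable_funV.
have mq : measurable_fun setT q.
  apply: measurable_funM => //; apply: measurable_funD => //.
  by apply: measurable_funM => //; apply: measurable_funV; exact: measurable_funX.
(* The substitution runs over the whole line, where [h] takes its values a second time for s < 0;
   the indicator in the density removes that branch. *)
rewrite (@ge0_integral_lebesgue_substitution R h (fun s => q s * \1_`]0%R, +oo[ s)%R)//.
- rewrite [RHS]integral_mkcond; apply: eq_integral => s _; rewrite patchE indicE.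
  by case: ifP => _; rewrite ?mulr1 ?mulr0 ?mule0.
- by apply: measurable_funM => //; exact: measurable_indic.
- move=> s; rewrite mulr_ge0// /q; apply: divr_ge0 => //; apply: addr_ge0 => //.
  by rewrite divr_ge0 ?sqr_ge0 ?ltW.
move=> a b ab.
(* As [h] reverses the order, this interval is the part of the preimage of []a, b]] in s > 0. *)
transitivity (\int[mu]_(s in `[sigma b, sigma a[) (q s)%:E).
  rewrite integral_mkindic [RHS]integral_mkindic; apply: eq_integral => s _; congr EFin.
  rewrite -mulrA; congr (_ * _)%R; rewrite !indicE -natrM mulnb; congr ((_ : bool)%:R).
  apply/andP/idP; rewrite !inE/= !in_itv/= ?andbT.
    by move=> [s0]; rewrite h_gt// leNgt h_gt// -leNgt andbC.
  move=> /andP[bs sa]; have s0 : (0 < s)%R by exact: lt_le_trans bs.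
  by rewrite s0 h_gt// leNgt h_gt// -leNgt bs sa.
have ba : (sigma b < sigma a)%R.
  by rewrite -h_gt// h_sigma.
rewrite integral_itv_bndo_bndc; last exact/measurable_EFinP/measurable_funTS.
have derivable_h x : (0 < x)%R -> derivable (fun s => - h s)%R x 1%R.
  by move=> x0; exact: (@ex_derive _ _ _ _ _ _ _ (is_derive_h x0)).
have derivable_q x : (0 < x)%R -> derivable q x 1%R.
  move=> x0; apply: derivableM => //; apply: derivableD => //.
  apply: derivableM => //; apply: derivableV; first by rewrite expf_eq0/= gt_eqF.
  exact: exprn_derivable.
have cont (f : R -> R) x : (0 < x)%R ->
    (forall x, (0 < x)%R -> derivable f x 1%R) -> {for x, continuous f}.
  by move=> x0 df; apply/differentiable_continuous/derivable1_diffP/df.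
rewrite (@continuous_FTC2 _ _ (fun s => - h s)%R)//.
- by rewrite !h_sigma -EFinB; congr EFin; ring.
- apply: derivable_oo_LRcontinuous_within; split.
  + move=> x; rewrite in_itv/= => /andP[bx _].
    exact: derivable_q (lt_trans _ bx).
  + by apply/cvg_at_right_filter; exact: cont derivable_q.
  + by apply/cvg_at_left_filter; exact: cont derivable_q.
- split.
  + move=> x; rewrite in_itv/= => /andP[bx _].
    exact: derivable_h (lt_trans _ bx).
  + by apply/cvg_at_right_filter; exact: cont derivable_h.
  + by apply/cvg_at_left_filter; exact: cont derivable_h.
- move=> x; rewrite in_itv/= => /andP[bx _].
  have x0 : (0 < x)%R by exact: lt_trans bx.
  by rewrite derive1E; exact: (@derive_val _ _ _ _ _ _ _ (is_derive_h x0)).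
Qed.

End hyperbola_substitution.

Section stereographic.
Local Open Scope ereal_scope.
Context (R : realType).
Local Notation mu := (@lebesgue_measure R).

Lemma ge0_integral_Rn_scale n (c : R) (G : borelRn R n -> \bar R) : c != 0%R ->
  measurable_fun setT G -> (forall x, 0 <= G x) ->
  \int[lebesgue_Rn R n]_x G x =
  (`|c| ^+ n)%:E * \int[lebesgue_Rn R n]_x G (c *: (x : 'rV[R]_n) : borelRn R n)%R.
Proof.
move=> c0 mG G0; rewrite (@ge0_integral_lebesgue_Rn_affine _ _ c 0%R)//.
by congr (_ * _); apply: eq_integral => x _; rewrite addr0.
Qed.

(* The point (a, w) with |(a, w)| - a = 1. *)
Definition cone_stereo n (w : 'rV[R]_n) : borelRn R n.+1 :=
  cons_row ((dot w w - 1) / 2, w : borelRn R n)%R.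

Lemma measurable_cone_stereo n d (T : measurableType d) (f : T -> borelRn R n) :
  measurable_fun setT f -> measurable_fun setT (fun t => cone_stereo (f t)).
Proof.
move=> mf; apply: (measurableT_comp (@measurable_cons_row R n)).
apply: measurable_fun_pair => //; apply: measurable_funM => //.
by apply: measurable_funB => //; exact: measurable_dot.
Qed.

(** [K] is the integrand after a has been replaced by s at fixed v, [H] the one after v = s w at
    fixed s. The tail v lives in dimension [d.+1], at least 1, so that v = 0 is negligible. *)
Lemma ge0_integral_cone d (G : borelRn R d.+2 -> \bar R) :
  measurable_fun setT G -> (forall x, 0 <= G x) ->
  \int[lebesgue_Rn R d.+2]_x G x =
  \int[lebesgue_Rn R d.+1]_w \int[mu]_(s in `]0%R, +oo[)
    (G (s *: (cone_stereo w : 'rV[R]_d.+2) : borelRn R d.+2)%R *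
     ((dot (w : 'rV[R]_d.+1) w + 1) / 2 * s ^+ d.+1)%:E).
Proof.
move=> mG G0; rewrite ge0_integral_lebesgue_RnS//.
pose I : R -> R := \1_`]0%R, +oo[.
have mI : measurable_fun setT I by exact: measurable_indic.
have I0 s : (0 <= I s)%R by rewrite /I indicE.
pose dw (w : 'rV[R]_d.+1) := dot w w.
pose K (z : borelRn R d.+1 * R) :=
  G (cons_row ((dw z.1 / z.2 - z.2) / 2, z.1)%R) *
  ((dw z.1 / z.2 ^+ 2 + 1) / 2 * I z.2)%:E.
have m1 : measurable_fun setT (fun z : borelRn R d.+1 * R => z.1).
  exact: measurable_fst.
have m2 : measurable_fun setT (fun z : borelRn R d.+1 * R => z.2).
  exact: measurable_snd.
have mdw : measurable_fun setT (fun z : borelRn R d.+1 * R => dw z.1).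
  exact: measurable_dot.
have mK : measurable_fun setT K.
  apply: emeasurable_funM.
    apply: (measurableT_comp mG); apply: (measurableT_comp (@measurable_cons_row R _)).
    apply: measurable_fun_pair => //; apply: measurable_funM => //.
    by apply: measurable_funB => //; apply: measurable_funM => //; exact: measurable_funV.
  apply/measurable_EFinP; apply: measurable_funM; last exact: (measurableT_comp mI).
  apply: measurable_funM => //; apply: measurable_funD => //.
  by apply: measurable_funM => //; apply: measurable_funV; exact: measurable_funX.
have K0 z : 0 <= K z.
  rewrite mule_ge0// lee_fin mulr_ge0// divr_ge0// addr_ge0//.
  by rewrite divr_ge0 ?sqr_ge0 ?dot_ge0.
(* The hyperbola substitution with c = |v|^2 needs v nonzero. *)
transitivity (\int[lebesgue_Rn R d.+1]_v \int[mu]_s K (v, s)).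
  apply: ae_eq_integral => //.
  - exact: measurable_integral_cons_row.
  - exact: (@measurable_fun_fubini_tonelli_F _ _ _ _ R mu K).
  exists [set 0%R : 'rV[R]_d.+1]; split; [exact: measurable_Rn_set0|exact: lebesgue_Rn_set0|].
  move=> v /=; apply: contra_notP => /eqP v0 _.
  rewrite (@ge0_integral_hyperbola _ (dw v)); last 3 first.
  - by rewrite lt_neqAle dot_ge0 eq_sym dot_eq0 v0.
  - apply: (measurableT_comp mG); exact: measurable_cons_row_l.
  - by move=> a; exact: G0.
  rewrite integral_mkcond; apply: eq_integral => s _; rewrite patchE /K /I /= indicE.
  by case: ifP => _; rewrite ?mulr1 ?mulr0 ?mule0.
pose H (z : borelRn R d.+1 * R) :=
  G (z.2 *: (cone_stereo z.1 : 'rV[R]_d.+2) : borelRn R d.+2)%R *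
     ((dw z.1 + 1) / 2 * z.2 ^+ d.+1 * I z.2)%:E.
have mH : measurable_fun setT H.
  apply: emeasurable_funM.
    apply: (measurableT_comp mG); apply: measurable_scalerow => //.
    exact: measurable_cone_stereo.
  apply/measurable_EFinP; apply: measurable_funM; last exact: (measurableT_comp mI).
  apply: measurable_funM => //; last exact: measurable_funX.
  by apply: measurable_funM => //; exact: measurable_funD.
have H0 z : 0 <= H z.
  have [/ltW z20|z20] := ltP 0%R z.2.
    rewrite mule_ge0// lee_fin !mulr_ge0// ?exprn_ge0// ?addr_ge0//; exact: dot_ge0.
  rewrite /H /I indicE memNset ?mulr0 ?mule0//= in_itv/= andbT.
  by move=> /lt_geF; rewrite z20.
transitivity (\int[lebesgue_Rn R d.+1]_w \int[mu]_s H (w, s)); last first.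
  apply: eq_integral => w _; rewrite [RHS]integral_mkcond.
  apply: eq_integral => s _; rewrite patchE /H /I /= indicE.
  by case: ifP => _; rewrite ?mulr1 ?mulr0 ?mule0.
transitivity (\int[mu]_s \int[lebesgue_Rn R d.+1]_w K (w, s)).
  exact: (@fubini_tonelli _ _ _ _ _ (lebesgue_Rn R d.+1) mu K mK K0).
transitivity (\int[mu]_s \int[lebesgue_Rn R d.+1]_w H (w, s)); last first.
  by symmetry; exact: (@fubini_tonelli _ _ _ _ _ (lebesgue_Rn R d.+1) mu H mH H0).
apply: eq_integral => s _.
have [s0|s0] := ltP 0%R s; last first.
  have Is : I s = 0%R.
    rewrite /I indicE memNset//= in_itv/= andbT; by move=> /lt_geF; rewrite s0.
  by rewrite !integral0_eq// => w _; rewrite /K /H /= Is mulr0 mule0.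
(* The dilation v = s w yields s^(d+1) and turns |v|^2 / s^2 into |w|^2. *)
rewrite (@ge0_integral_Rn_scale _ s)//; last 2 first.
- by rewrite gt_eqF.
- by apply: (measurableT_comp mK); exact: measurable_fun_pair.
rewrite -ge0_integralZl//.
- apply: eq_integral => w _; rewrite /K /H /= muleCA -EFinM; congr (_ * _%:E).
    rewrite /cone_stereo cons_rowZ; congr (G (cons_row (_, _))).
    rewrite /dw dotZl dotZr; field; lra.
  rewrite gtr0_norm// /dw dotZl dotZr; field; lra.
- apply: (measurableT_comp mK); apply: measurable_fun_pair => //.
  exact: (@measurable_scalerow _ _ _ _ (cst s)).
Qed.

End stereographic.

(** * Surface measure in stereographic coordinates *)

Section surface.
Local Open Scope ereal_scope.
Context (R : realType).
Local Notation mu := (@lebesgue_measure R).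

(** [radial_sector A] is the preimage of [A] under normalization, cut to the punctured ball; so the
    surface measure is the image of [d.+1] times Lebesgue measure on that ball. *)
Lemma ge0_integral_surface d (g : borelRn R d.+1 -> \bar R) :
  measurable_fun setT g -> (forall x, 0 <= g x) ->
  \int[surface_measure R d]_y g y =
  \int[lebesgue_Rn R d.+1]_x
    (g ((enorm (x : 'rV[R]_d.+1))^-1 *: (x : 'rV[R]_d.+1) : borelRn R d.+1)%R *
     (d.+1%:R * \1_(punctured_ball R d.+1) x)%:E).
Proof.
have mD : measurable (punctured_ball R d.+1) := @measurable_punctured_ball R d.+1.
move=> mg g0.
have mn := @measurable_normalize R d.+1.
apply: (@ge0_integral_density _ _ _ _ _ _ (lebesgue_Rn R d.+1) _
  (fun x => d.+1%:R * \1_(punctured_ball R d.+1) x)%R) => //.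
- by apply: measurable_funM => //; exact: measurable_indic.
- move=> A mA; rewrite /surface_measure.
  have mhA := mn measurableT _ mA; rewrite setTI in mhA.
  under [RHS]eq_integral do rewrite EFinM.
  rewrite ge0_integralZl//; last first.
    by apply/measurable_EFinP/measurable_funTS; exact: measurable_indic.
  by rewrite integral_indic.
Qed.

(** Inverse stereographic projection from the pole (1, 0): the point [cone_stereo w] has norm (|w|^2
    + 1) / 2, and is divided by it. *)
Definition stereo n (w : 'rV[R]_n) : borelRn R n.+1 :=
  ((2 / (dot w w + 1)) *: (cone_stereo w : 'rV[R]_n.+1))%R.

Lemma measurable_stereo n :
  measurable_fun setT (fun w : borelRn R n => stereo w).
Proof.
apply: measurable_scalerow; last exact: measurable_cone_stereo.
apply: measurable_funM => //; apply: measurable_funV.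
by apply: measurable_funD => //; exact: measurable_dot.
Qed.

Lemma dot_add1_gt0 n (w : 'rV[R]_n) : (0 < dot w w + 1)%R.
Proof. by rewrite ltr_wpDl// dot_ge0. Qed.

Lemma dot_cone_stereo n (w : 'rV[R]_n) :
  dot (cone_stereo w : 'rV[R]_n.+1) (cone_stereo w) = (((dot w w + 1) / 2) ^+ 2)%R.
Proof. by rewrite dot_cons_row; field. Qed.

Lemma enorm_cone_stereo n (w : 'rV[R]_n) :
  enorm (cone_stereo w : 'rV[R]_n.+1) = ((dot w w + 1) / 2)%R.
Proof.
rewrite enormE dot_cone_stereo sqrtr_sqr ger0_norm// divr_ge0// ltW//.
exact: dot_add1_gt0.
Qed.

Lemma ge0_integral_surface_stereo d (g : borelRn R d.+2 -> \bar R) :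
  measurable_fun setT g -> (forall x, 0 <= g x) ->
  \int[surface_measure R d.+1]_y g y =
  \int[lebesgue_Rn R d.+1]_w
    (g (stereo w) * ((2 / (dot (w : 'rV[R]_d.+1) w + 1)) ^+ d.+1)%:E).
Proof.
move=> mg g0; rewrite ge0_integral_surface//.
have mD : measurable (punctured_ball R d.+2) := @measurable_punctured_ball R d.+2.
have mn := @measurable_normalize R d.+2.
rewrite ge0_integral_cone; last 2 first.
- apply: emeasurable_funM; first exact: (measurableT_comp mg).
  by apply/measurable_EFinP; apply: measurable_funM => //; exact: measurable_indic.
- by move=> x; rewrite mule_ge0// lee_fin mulr_ge0.
apply: eq_integral => w _.
have q0 := dot_add1_gt0 w; set q := (dot w w + 1)%R in q0 *.
have p0 : (0 < 2 / q)%R by rewrite divr_gt0.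
(* Along a ray [g] is constant, and |s x| < 1 means s < 2 / q. The integral of (d+2) s^(d+1) is then
   (2 / q)^(d+2), of which the factor q / 2 cancels one power. *)
transitivity (\int[mu]_(s in `]0%R, (2 / q)%R[)
    (g (stereo w) * (q / 2)%:E * (d.+2%:R * s `^ (d.+2%:R - 1))%:E)).
  rewrite integral_mkcond [RHS]integral_mkcond; apply: eq_integral => s _.
  rewrite !patchE; have [s0|s0] := ltP 0%R s; last first.
    by rewrite !memNset//= in_itv/= => /andP[] /lt_geF; rewrite s0.
  rewrite mem_set; last by rewrite /= in_itv/= s0.
  have nE : enorm (s *: (cone_stereo w : 'rV[R]_d.+2)) = (s * (q / 2))%R.
    by rewrite enormZ enorm_cone_stereo gtr0_norm.
  have sq0 : (0 < s * (q / 2))%R by rewrite mulr_gt0// divr_gt0.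
  have DE : punctured_ball R d.+2 (s *: (cone_stereo w : 'rV[R]_d.+2)) <-> (s < 2 / q)%R.
    rewrite /punctured_ball/= nE sq0/= -ltr_pdivlMr ?divr_gt0// div1r invf_div//.
  rewrite indicE; case: ifPn => [|nsq]; last first.
    rewrite memNset ?mulr0 ?mule0 ?mul0e// => /DE sq.
    by move: nsq; rewrite mem_set//= in_itv/= s0.
  rewrite inE/= in_itv/= => /andP[_ sq]; rewrite mem_set; last exact/DE.
  rewrite nE scalerA (_ : (_^-1 * s = 2 / q)%R); last first.
    by field; rewrite !gt_eqF.
  rewrite -/(stereo w) mulr1 -!muleA -!EFinM; congr (_ * _%:E).
  rewrite (_ : d.+2%:R - 1 = d.+1%:R)%R; last by rewrite -natr1 addrK.
  by rewrite powR_mulrn ?ltW//; ring.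
have mpow : measurable_fun setT (fun s : R => s `^ (d.+2%:R - 1))%R.
  exact: measurable_powR.
rewrite ge0_integralZl//.
- rewrite integral_powR//; last by rewrite ler1n.
  rewrite powR_mulrn ?ltW// -muleA -EFinM exprS mulrA.
  congr (_ * _%:E); rewrite (_ : q / 2 * (2 / q) = 1)%R ?mul1r//; field.
  by rewrite gt_eqF.
- by apply/measurable_EFinP/measurable_funTS/measurable_funM.
- by move=> s _; rewrite lee_fin mulr_ge0// powR_ge0.
- by rewrite mule_ge0// lee_fin divr_ge0// ltW.
Qed.

End surface.

(** * Moebius transformations *)

Section mobius.
Context (R : realType).

(** On the sphere, this is the local dilation ratio of M_(I,-phi); its d-th power is the spherical
    Cauchy density on S^d up to the normalizing constant. *)
Definition conformal_factor n (phi y : 'rV[R]_n) : R :=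
  `|1 - enorm phi ^+ 2| / enorm (y - phi) ^+ 2.

Definition axis n (rho : R) : 'rV[R]_n.+1 := cons_row (rho, (0 : 'rV[R]_n) : borelRn R n).

Lemma stereoE n (w : 'rV[R]_n) :
  stereo w = cons_row ((dot w w - 1) / (dot w w + 1),
    ((2 / (dot w w + 1)) *: w : borelRn R n)).
Proof.
rewrite /stereo /cone_stereo cons_rowZ; congr cons_row; congr pair.
by field; rewrite gt_eqF// dot_add1_gt0.
Qed.

Lemma sqr_enorm_axis n rho : enorm (axis n rho) ^+ 2 = rho ^+ 2.
Proof. by rewrite sqr_enorm dot_cons_row /dot big1 ?addr0// => i _; rewrite mxE mul0r. Qed.

Lemma axisN n rho : - axis n rho = axis n (- rho).
Proof. by rewrite -scaleN1r /axis cons_rowZ mulN1r scaler0. Qed.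

Lemma sqr_enorm_stereo_axis n (rho : R) (w : 'rV[R]_n) :
  enorm ((stereo w : 'rV[R]_n.+1) - axis n rho) ^+ 2 =
  ((1 - rho) ^+ 2 * dot w w + (1 + rho) ^+ 2) / (dot w w + 1).
Proof.
rewrite axisN stereoE /axis cons_rowD addr0 sqr_enorm dot_cons_row dotZl dotZr.
by field; rewrite gt_eqF// dot_add1_gt0.
Qed.

Section axis.
Variables (n : nat) (rho : R).
Hypotheses (rho0 : 0 <= rho) (rho1 : rho != 1).
Let c := (1 - rho) / (1 + rho).
Let rhop : 1 + rho != 0.
Proof. by rewrite gt_eqF// ltr_wpDr. Qed.

Let den_gt0 u : 0 <= u -> 0 < (1 - rho) ^+ 2 * u + (1 + rho) ^+ 2.
Proof.
move=> u0; apply: ltr_wpDl; first by rewrite mulr_ge0 ?sqr_ge0.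
by rewrite lt0r sqr_ge0 expf_eq0/= rhop.
Qed.

Let den_scale u : ((1 - rho) / (1 + rho)) * (((1 - rho) / (1 + rho)) * u) + 1 =
  ((1 - rho) ^+ 2 * u + (1 + rho) ^+ 2) / (1 + rho) ^+ 2.
Proof. by field. Qed.

Lemma mobius_stereo (w : 'rV[R]_n) :
  mobius (- axis n rho) (stereo w) = stereo (c *: w).
Proof.
have u0 := dot_ge0 w; have q0 := dot_add1_gt0 w; have d0 := den_gt0 u0.
rewrite /mobius sqr_enorm_stereo_axis axisN sqr_enorm_axis sqrrN !stereoE.
rewrite /axis cons_rowD addr0 cons_rowZ cons_rowD addr0 dotZl dotZr.
rewrite !scalerA /c den_scale; move: (dot w w) u0 q0 d0 => u u0 q0 d0.
congr cons_row; congr pair.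
  by field; rewrite rhop !gt_eqF.
congr (_ *: _); by field; rewrite rhop !gt_eqF.
Qed.

(** Chain rule for conformal factors: 2 / (1 + |w|^2) belongs to [stereo] at w, [|c|] to the
    dilation. The absolute value matters, as c < 0 for rho > 1. *)
Lemma conformal_factor_stereo (w : 'rV[R]_n) :
  conformal_factor (axis n rho) (stereo w) * (2 / (dot w w + 1)) =
  `|c| * (2 / (dot (c *: w) (c *: w) + 1)).
Proof.
have u0 := dot_ge0 w; have q0 := dot_add1_gt0 w; have d0 := den_gt0 u0.
rewrite /conformal_factor sqr_enorm_stereo_axis sqr_enorm_axis dotZl dotZr.
rewrite /c den_scale; move: (dot w w) u0 q0 d0 => u u0 q0 d0.
rewrite normrM normfV (ger0_norm (_ : 0 <= 1 + rho)) ?addr_ge0//.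
rewrite (_ : 1 - rho ^+ 2 = (1 - rho) * (1 + rho)); last by ring.
rewrite normrM (ger0_norm (_ : 0 <= 1 + rho)) ?addr_ge0//.
by field; rewrite rhop !gt_eqF.
Qed.

End axis.

(** * Reflections in hyperplanes *)

Section reflection.
Variables (n : nat) (u : 'rV[R]_n).

(* For u = 0 the quotient is 0 and the map is the identity. *)
Definition reflection (x : 'rV[R]_n) : 'rV[R]_n := x - (2 * dot x u / dot u u) *: u.

Lemma reflectionD x y : reflection (x + y) = reflection x + reflection y.
Proof. by rewrite /reflection dotDl mulrDr mulrDl scalerDl opprD addrACA. Qed.

Lemma reflectionZ a x : reflection (a *: x) = a *: reflection x.
Proof. by rewrite /reflection dotZl scalerBr scalerA; congr (_ - _ *: _); ring. Qed.

Lemma reflectionN x : reflection (- x) = - reflection x.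
Proof. by rewrite -scaleN1r reflectionZ scaleN1r. Qed.

Lemma dot_reflection x : dot (reflection x) (reflection x) = dot x x.
Proof.
rewrite /reflection !dotE (dotC u x).
have [->|uu0] := eqVneq (dot u u) 0; first by rewrite invr0; ring.
by field.
Qed.

Lemma enorm_reflection x : enorm (reflection x) = enorm x.
Proof. by rewrite !enormE dot_reflection. Qed.

Lemma reflectionK : involutive reflection.
Proof.
move=> x; rewrite /reflection !dotE.
have [->|uu0] := eqVneq (dot u u) 0; first by rewrite invr0 !mulr0 scale0r !subr0.
rewrite -addrA -opprD -scalerDl [X in X *: u](_ : _ = 0) ?scale0r ?subr0//.
by field.
Qed.

Lemma measurable_reflection :
  measurable_fun setT (reflection : borelRn R n -> borelRn R n).
Proof.
rewrite (_ : reflection = fun x => x + (- (2 * dot x u / dot u u)) *: u); last first.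
  by apply/funext => x; rewrite /reflection scaleNr.
apply: measurable_addrow => //.
apply: (@measurable_scalerow _ _ _ _ _ (cst u)) => //.
apply: measurable_funN; apply: measurable_funM => //; apply: measurable_funM => //.
exact: (@measurable_dot _ _ _ _ _ (cst u)).
Qed.

End reflection.

(** Equal norms give 2 <x, x - y> = |x - y|^2, so the reflection subtracts exactly x - y. For x = y
    it is the identity. *)
Lemma reflection_swap n (x y : 'rV[R]_n) :
  enorm x = enorm y -> reflection (x - y) x = y.
Proof.
move=> xy; have dxy : dot x x = dot y y by rewrite -!sqr_enorm xy.
have [u0|u0] := eqVneq (dot (x - y) (x - y)) 0.
  rewrite /reflection u0 invr0 mulr0 scale0r subr0; apply/eqP.
  by rewrite -subr_eq0 -dot_eq0 u0.
rewrite /reflection (_ : 2 * _ / _ = 1) ?scale1r ?subKr ?opprB ?addrCA ?subrr ?addr0//.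
rewrite (_ : 2 * dot x (x - y) = dot (x - y) (x - y)) ?divff//.
by rewrite !dotE (dotC y x) -dxy; ring.
Qed.

(** The Moebius map is built from norms, sums and scalings, all respected by a linear isometry. *)
Lemma mobius_reflection d (u psi y : 'rV[R]_d.+1) :
  mobius (reflection u psi) (reflection u y) = reflection u (mobius psi y).
Proof.
by rewrite /mobius -reflectionD !enorm_reflection -reflectionZ -reflectionD.
Qed.

Lemma conformal_factor_reflection n (u phi y : 'rV[R]_n) :
  conformal_factor (reflection u phi) (reflection u y) = conformal_factor phi y.
Proof. by rewrite /conformal_factor -reflectionN -reflectionD !enorm_reflection. Qed.

Lemma measurable_conformal_factor n (phi : 'rV[R]_n) :
  measurable_fun setT (conformal_factor phi : borelRn R n -> R).
Proof.
apply: measurable_funM => //; apply: measurable_funV; apply: measurable_funX.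
by apply: measurable_enorm; exact: (@measurable_addrow _ _ _ _ _ (cst (- phi))).
Qed.

Lemma conformal_factor_ge0 n (phi y : 'rV[R]_n) : 0 <= conformal_factor phi y.
Proof. by rewrite divr_ge0 ?sqr_ge0. Qed.

Lemma measurable_mobius d (psi : 'rV[R]_d.+1) :
  measurable_fun setT (mobius psi : borelRn R d.+1 -> borelRn R d.+1).
Proof.
have ma : measurable_fun setT
    (fun y : borelRn R d.+1 => (y : 'rV[R]_d.+1) + psi : borelRn R d.+1).
  exact: (@measurable_addrow _ _ _ _ _ (cst psi)).
apply: (@measurable_addrow _ _ _ _ _ (cst psi)) => //.
apply: measurable_scalerow => //.
apply: measurable_funM => //; apply: measurable_funV; apply: measurable_funX.
exact: measurable_enorm.
Qed.

(** With k = 1 - |psi|^2 and inv(z) = k z / |z|^2, the two maps are y |-> inv(y + psi) + psi and z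
    |-> inv(z - psi) - psi, and inv is an involution away from 0. *)
Lemma mobiusK d (psi y : 'rV[R]_d.+1) : enorm psi != 1 -> y + psi != 0 ->
  mobius (- psi) (mobius psi y) = y.
Proof.
move=> psi1 z0; have r0 : dot (y + psi) (y + psi) != 0 by rewrite dot_eq0.
have k0 : 1 - dot psi psi != 0.
  rewrite -sqr_enorm -[1](expr1n _ 2) subr_sqr mulf_neq0//.
    by rewrite subr_eq0 eq_sym.
  by rewrite gt_eqF// ltr_wpDr ?enorm_ge0.
rewrite /mobius addrK !sqr_enorm dotNl dotNr opprK dotZl dotZr scalerA.
rewrite [X in X *: _](_ : _ = 1); first by rewrite scale1r addrK.
by field; rewrite r0 k0.
Qed.

Lemma enorm_mobius d (psi y : 'rV[R]_d.+1) : enorm y = 1 -> y + psi != 0 ->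
  enorm (mobius psi y) = 1.
Proof.
move=> y1 z0; have r0 : dot (y + psi) (y + psi) != 0 by rewrite dot_eq0.
rewrite enormE /mobius !sqr_enorm -[RHS]sqrtr1; congr Num.sqrt.
have {y1} : dot y y = 1 by rewrite -sqr_enorm y1 expr1n.
move: r0; rewrite !dotE (dotC psi y) => r0 yy; rewrite yy in r0 *.
by field.
Qed.

Lemma addr_neq0_enorm n (psi y : 'rV[R]_n) : enorm y != enorm psi -> y + psi != 0.
Proof.
apply: contra_neq => /eqP; rewrite addr_eq0 => /eqP ->.
by rewrite !enormE dotNl dotNr opprK.
Qed.

End mobius.

(** * Change of variables on the sphere under a Moebius transformation *)

Section change_of_variables.
Local Open Scope ereal_scope.
Context (R : realType).

Lemma ge0_integral_surface_reflection d (u : 'rV[R]_d.+1) (g : borelRn R d.+1 -> \bar R) :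
  measurable_fun setT g -> (forall x, 0 <= g x) ->
  \int[surface_measure R d]_y g (reflection u y) = \int[surface_measure R d]_y g y.
Proof.
move=> mg g0; have mT := measurable_reflection u.
have mD : measurable (punctured_ball R d.+1) := @measurable_punctured_ball R d.+1.
have mn := @measurable_normalize R d.+1.
rewrite [RHS]ge0_integral_surface// (ge0_integral_surface (measurableT_comp mg mT));
  last by move=> x; exact: g0.
rewrite -[RHS](@ge0_integral_Rn_isometry _ _ (reflection u)); last 6 first.
- exact: reflectionD.
- exact: reflectionK.
- exact: enorm_reflection.
- exact: mT.
- apply: emeasurable_funM; first exact: (measurableT_comp mg).
  by apply/measurable_EFinP; apply: measurable_funM => //; exact: measurable_indic.
- by move=> x; rewrite mule_ge0// lee_fin mulr_ge0.
apply: eq_integral => x _ /=; rewrite enorm_reflection reflectionZ; congr (_ * (_ * _)%:E).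
rewrite !indicE; congr ((_ : bool)%:R).
by apply/idP/idP; rewrite !inE /punctured_ball/= enorm_reflection.
Qed.

(** In stereographic coordinates both sides are integrals over the w-space, and the dilation by (1 -
    rho) / (1 + rho) carries one to the other. *)
Lemma ge0_integral_surface_axis d (rho : R) (g : borelRn R d.+2 -> \bar R) :
  (0 <= rho)%R -> rho != 1%R ->
  measurable_fun setT g -> (forall x, 0 <= g x) ->
  \int[surface_measure R d.+1]_y g y =
  \int[surface_measure R d.+1]_y
    (g (mobius (- axis d.+1 rho)%R y) * (conformal_factor (axis d.+1 rho) y ^+ d.+1)%:E).
Proof.
move=> rho0 rho1 mg g0.
have mgM := measurableT_comp mg (measurable_mobius (- axis d.+1 rho)%R).
have mq : measurable_fun setT (fun w : borelRn R d.+1 =>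
    ((2 / (dot (w : 'rV[R]_d.+1) w + 1)) ^+ d.+1)%:E).
  apply/measurable_EFinP; apply: measurable_funX; apply: measurable_funM => //.
  by apply: measurable_funV; apply: measurable_funD => //; exact: measurable_dot.
have q0 (w : 'rV[R]_d.+1) : (0 <= (2 / (dot w w + 1)) ^+ d.+1)%R.
  by rewrite exprn_ge0// divr_ge0// ltW// dot_add1_gt0.
rewrite !ge0_integral_surface_stereo//; last 2 first.
- apply: emeasurable_funM => //; apply/measurable_EFinP; apply: measurable_funX.
  exact: measurable_conformal_factor.
- by move=> y; rewrite mule_ge0// lee_fin exprn_ge0// conformal_factor_ge0.
have c0 : ((1 - rho) / (1 + rho) != 0)%R.
  apply: mulf_neq0; first by rewrite subr_eq0 eq_sym.
  by rewrite invr_eq0 gt_eqF// ltr_wpDr.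
have mF : measurable_fun setT (fun w : borelRn R d.+1 =>
    g (stereo w) * ((2 / (dot (w : 'rV[R]_d.+1) w + 1)) ^+ d.+1)%:E).
  by apply: emeasurable_funM => //; exact: (measurableT_comp mg (@measurable_stereo _ _)).
rewrite (@ge0_integral_Rn_scale _ _ ((1 - rho) / (1 + rho))%R)//; last first.
  by move=> w; rewrite mule_ge0// lee_fin.
rewrite -ge0_integralZl//; last 2 first.
- apply: (measurableT_comp mF).
  exact: (@measurable_scalerow _ _ _ _ (cst ((1 - rho) / (1 + rho))%R)).
- by move=> w _; rewrite mule_ge0// lee_fin.
apply: eq_integral => w _.
rewrite mobius_stereo// muleCA -!muleA -!EFinM; congr (_ * _%:E).
by rewrite -!exprMn conformal_factor_stereo.
Qed.

Lemma ge0_integral_surface_mobius d (phi : 'rV[R]_d.+2) (g : borelRn R d.+2 -> \bar R) :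
  enorm phi != 1%R ->
  measurable_fun setT g -> (forall x, 0 <= g x) ->
  \int[surface_measure R d.+1]_y g y =
  \int[surface_measure R d.+1]_y
    (g (mobius (- phi)%R y) * (conformal_factor phi y ^+ d.+1)%:E).
Proof.
move=> phi1 mg g0; pose a := axis d.+1 (enorm phi); pose T := reflection (phi - a)%R.
have mT : measurable_fun setT (T : borelRn R d.+2 -> borelRn R d.+2).
  exact: measurable_reflection.
have Tphi : T phi = a.
  apply: reflection_swap; rewrite [RHS]enormE -sqr_enorm sqr_enorm_axis.
  by rewrite sqrtr_sqr ger0_norm ?enorm_ge0.
(* Reflection invariance is used twice, before and after the axis case, so that M_(I,-a) is
   conjugated by [T] into M_(I,-phi). *)
pose H (y : borelRn R d.+2) := g (T (mobius (- a)%R y)) * (conformal_factor a y ^+ d.+1)%:E.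
have mH : measurable_fun setT H.
  apply: emeasurable_funM.
    exact: (measurableT_comp (measurableT_comp mg mT) (measurable_mobius (- a)%R)).
  apply/measurable_EFinP; apply: measurable_funX; exact: measurable_conformal_factor.
have H0 y : 0 <= H y by rewrite mule_ge0// lee_fin exprn_ge0// conformal_factor_ge0.
rewrite -(ge0_integral_surface_reflection (phi - a)%R mg g0).
transitivity (\int[surface_measure R d.+1]_y H y).
  apply: (ge0_integral_surface_axis (enorm_ge0 phi) phi1 (measurableT_comp mg mT)).
  by move=> y; exact: g0.
rewrite -(ge0_integral_surface_reflection (phi - a)%R mH H0).
apply: eq_integral => y _; rewrite /H -[reflection _ y]/(T y).
have -> : (- a = T (- phi))%R by rewrite /T reflectionN -/T Tphi.
rewrite -Tphi; congr (g _ * (_ ^+ _)%:E); last by rewrite /T conformal_factor_reflection.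
by rewrite /T mobius_reflection reflectionK.
Qed.

End change_of_variables.

(** * Area of the sphere and conclusion *)

Section area.
Local Open Scope ereal_scope.
Context (R : realType).
Local Notation mu := (@lebesgue_measure R).

Lemma surface_measure_sphere d :
  surface_measure R d (sphere R d) =
  d.+1%:R%:E * lebesgue_Rn R d.+1 (punctured_ball R d.+1).
Proof.
rewrite /surface_measure (_ : radial_sector _ = punctured_ball R d.+1)//.
apply/seteqP; split => x /=; first by case.
move=> x01; split => //; rewrite /sphere /= enormZ.
case/andP: x01 => x0 _; rewrite gtr0_norm ?invr_gt0// mulVf// gt_eqF//.
Qed.

Lemma surface_measure_setC_sphere d :
  surface_measure R d (~` sphere R d) = 0.
Proof.
rewrite /surface_measure (_ : radial_sector _ = set0) ?measure0 ?mule0//.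
apply/seteqP; split => // x [/andP[x0 _]] /=; apply.
by rewrite /sphere /= enormZ gtr0_norm ?invr_gt0// mulVf// gt_eqF//.
Qed.

Lemma measurable_sphere d : measurable (sphere R d : set (borelRn R d.+1)).
Proof.
have := @measurable_enorm R _ _ d.+1 id (@measurable_id _ (borelRn R d.+1) setT).
by move=> /(_ measurableT _ (measurable_set1 1%R)); rewrite setTI.
Qed.

(** With v the volume of the unit ball of R^(d+2), the area is (d+2) v, while the Gaussian identity
    reads pi^((d+2)/2) = v (d+2)/2 Gamma((d+2)/2). *)
Lemma surface_measure_sphere_cst d :
  let c : R := (Gamma (d.+2%:R / 2 : R) / (2 * pi `^ (d.+2%:R / 2)))%R in
  (0 < c)%R /\ surface_measure R d.+1 (sphere R d.+1) = (c^-1)%:E.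
Proof.
have [v v0 vE] := @volume_punctured_ball_gt0 R d.+2 isT.
rewrite surface_measure_sphere vE -EFinM.
have := gauss_volume R (isT : 0 < d.+2)%N; rewrite vE Gamma_succ; last first.
  by rewrite ler_pdivlMr// mul1r ler_nat.
rewrite /Gamma /Rintegral.
set I := (X in _ * (_ * X)).
have I0 : 0 <= I.
  by apply: integral_ge0 => t _; rewrite lee_fin mulr_ge0 ?powR_ge0 ?expR_ge0.
have p0 : (0 < Num.sqrt pi ^+ d.+2 :> R)%R by rewrite exprn_gt0// sqrtr_gt0 pi_gt0.
rewrite (_ : pi `^ (d.+2%:R / 2) = Num.sqrt pi ^+ d.+2 :> R)%R; last first.
  rewrite -powR12_sqrt ?pi_ge0// -powR_mulrn ?powR_ge0//.
  by rewrite -powRrM mulrC.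
rewrite muleA -EFinM muleC => E.
have va0 : 0 <= (v * (d.+2%:R / 2))%:E.
  by rewrite lee_fin mulr_ge0 ?divr_ge0// ltW.
(* [Gamma] is the real part [fine] of an extended integral, so its finiteness has to be known before
   it can enter the identity. *)
have [s s0 sE] := pos_fin_num_factor p0 I0 va0 E.
move: E; rewrite sE /= -EFinM => -[->].
rewrite [fine _](_ : _ = s); last by rewrite -[LHS]/(fine I) sE.
by split; [rewrite divr_gt0 ?mulr_gt0|congr EFin; field; rewrite !gt_eqF// ltr_wpDr].
Qed.

End area.

Theorem corollary3 (R : realType) (d : nat) (hd : (1 <= d)%N)
    (phi : 'rV[R]_d.+1) (hphi : phi \in ~` sphere R d)
    (A : set (borelRn R d.+1)) (hA : A `<=` sphere R d) (mA : measurable A) :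
  (\int[surface_measure R d]_(y in A) (spherical_cauchy phi y)%:E =
   surface_measure R d (mobius (- phi) @` A) /
   surface_measure R d (sphere R d))%E.
Proof.
(* From here on the sphere has dimension [d.+1]. *)
case: d hd phi hphi A hA mA => // d _ phi hphi A hA mA.
have {hphi} phi1 : enorm phi != 1 by apply/eqP => phi1; move: hphi; rewrite inE.
have z0 (y : 'rV[R]_d.+2) : enorm y = 1 -> y - phi != 0.
  by move=> y1; apply: addr_neq0_enorm; rewrite y1 eq_sym -scaleN1r enormZ normrN1 mul1r.
pose MA : set (borelRn R d.+2) := mobius (- phi) @` A.
have nN : enorm (- phi) != 1 by rewrite -scaleN1r enormZ normrN1 mul1r.
(* The image is rewritten as a preimage under the inverse map, which makes it a Borel set. *)
have MAE : MA = (sphere R d.+1 : set (borelRn R d.+2)) `&`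
    ((mobius phi : borelRn R d.+2 -> borelRn R d.+2) @^-1` A).
  apply/seteqP; split => z /=.
    move=> [y Ay <-]; have y1 : enorm y = 1 := hA _ Ay.
    split; first by apply: enorm_mobius => //; exact: z0.
    by rewrite -{1}(opprK phi) mobiusK//; exact: z0.
  move=> [z1 Az]; exists (mobius phi z) => //.
  by rewrite mobiusK//; apply: addr_neq0_enorm; rewrite [enorm z]z1 eq_sym.
have mMA : measurable MA.
  rewrite MAE; apply: measurableI; first exact: measurable_sphere.
  by rewrite -[X in measurable X]setTI; exact: measurable_mobius.
have J0 (y : 'rV[R]_d.+2) : 0 <= conformal_factor phi y ^+ d.+1.
  by rewrite exprn_ge0// conformal_factor_ge0.
have mJ : measurable_fun setT
    (fun y : borelRn R d.+2 => (conformal_factor phi y ^+ d.+1)%:E).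
  by apply/measurable_EFinP; apply: measurable_funX; exact: measurable_conformal_factor.
have area : surface_measure R d.+1 MA =
    (\int[surface_measure R d.+1]_(y in A) (conformal_factor phi y ^+ d.+1)%:E)%E.
  rewrite -[X in surface_measure R d.+1 X]setIT -integral_indic//.
  have m1 : measurable_fun setT (fun y : borelRn R d.+2 => (\1_MA y : R)%:E).
    by apply/measurable_EFinP; exact: measurable_indic.
  (* With the indicator of [MA] as integrand, the identity 1_MA(M y) = 1_A(y) remains; it is checked
     on the sphere, whose complement has surface measure 0. *)
  rewrite (ge0_integral_surface_mobius phi1)//.
  rewrite [RHS]integral_mkindic; apply: ae_eq_integral => //.
  - apply: emeasurable_funM => //; apply: (measurableT_comp m1).
    exact: measurable_mobius.
  - apply/measurable_EFinP; apply: measurable_funM; last exact: measurable_indic.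
    exact/measurable_EFinP.
  exists (~` (sphere R d.+1 : set (borelRn R d.+2))); split.
  - by apply: measurableC; exact: measurable_sphere.
  - exact: surface_measure_setC_sphere.
  move=> y /=; apply: contra_not => y1 _.
  rewrite muleC -EFinM !indicE; congr ((_ * (_ : bool)%:R)%:E).
  apply/idP/idP; rewrite !inE; last by move=> Ay; exists y.
  rewrite MAE /= -{1 2}(opprK phi) => -[_].
  by rewrite mobiusK//; exact: z0.
have [C0 sE] := @surface_measure_sphere_cst R d.
rewrite -/MA area sE inver invr_eq0 gt_eqF// invrK muleC.
rewrite /spherical_cauchy; under eq_integral do rewrite EFinM.
rewrite ge0_integralZl//.
- exact: measurable_funTS.
- by move=> y _; rewrite lee_fin; exact: J0.
- exact: ltW.
Qed.
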